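(* Let $p$ be a prime, let $q$ be a power of $p$ (that is, $q=p^k$ with $k\ge 1$), let $n$ be a positive divisor of $q-1$, and set $d=(q-1)/n$. Then $n\in\mathcal{N}_p$ provided that \[ q-\bigl((pd-p-d-1)d^{p-1}+2\bigr)\sqrt{q}-(p+1)d^{p-1}+1>0. \] Moreover, if $n$ is not a multiple of $p-1$, then the slightly weaker condition \[ q-\bigl((pd-p-d-1)d^{p-1}+2\bigr)\sqrt{q}-d^{p-1}+1>0 \] suffices for $n\in\mathcal{N}_p$.
   Context: For a prime $p$, $\mathcal{N}_p$ denotes the set of positive integers $n$ for which there exist a field $F$ of characteristic $p$ and a finite-dimensional non-nilpotent Lie algebra $L$ over $F$ which admits a nonsingular (that is, injective) derivation of order $n$. Here the order of a nonsingular derivation $D$ is its multiplicative order as an invertible linear map of $L$, i.e. the least positive integer $n$ with $D^n=\mathrm{id}_L$. *)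

(* Defs.v *)
From HB Require Import structures.
From mathcomp Require Import all_boot all_order all_algebra.
Set Implicit Arguments.
Unset Strict Implicit.
Unset Printing Implicit Defensive.
Import Order.TTheory GRing.Theory Num.Theory.
Local Open Scope ring_scope.

(* The alternating law is [x, x] = 0 and not mere antisymmetry, which is
   weaker in characteristic 2. *)
Definition is_lie_bracket (F : fieldType) (L : vectType F)
    (br : {bilinear L -> L -> L}) : Prop :=
  (forall x, br x x = 0) /\
  (forall x y z, br x (br y z) + br y (br z x) + br z (br x y) = 0).

(* [U, V] is the span of all brackets [u, v] with u in U and v in V. As for
   prodv in falgebra, brackets of basis elements suffice by bilinearity; see
   lie_prod_subP. *)
Definition lie_prod (F : fieldType) (L : vectType F)
    (br : {bilinear L -> L -> L}) (U V : {vspace L}) : {vspace L} :=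
  <<allpairs br (vbasis U) (vbasis V)>>%VS.

Lemma lie_prod_subP (F : fieldType) (L : vectType F)
    (br : {bilinear L -> L -> L}) (U V W : {vspace L}) :
  (forall u v, u \in U -> v \in V -> br u v \in W)
    <-> (lie_prod br U V <= W)%VS.
Proof.
split=> [UVW | sUVW u v Uu Vv].
  apply/span_subvP=> _ /allpairsP[[u v] /= [Uu Vv ->]].
  by rewrite UVW ?vbasis_mem.
rewrite (coord_vbasis Uu) (coord_vbasis Vv) linear_sumlz.
apply: rpred_sum => i _; rewrite linearZl_LR linear_sumr; apply: rpredZ.
apply: rpred_sum => j _; rewrite linearZr_LR; apply: rpredZ.
apply: (subvP sUVW); apply: memv_span; apply/allpairsP.
by exists ((vbasis U)`_i, (vbasis V)`_j); rewrite !mem_nth ?size_tuple.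
Qed.

(* Indexed from 0: the term of index c is the usual L^(c+1). *)
Fixpoint lower_central (F : fieldType) (L : vectType F)
    (br : {bilinear L -> L -> L}) (c : nat) : {vspace L} :=
  if c is c'.+1 then lie_prod br fullv (lower_central br c') else fullv.

Definition lie_nilpotent (F : fieldType) (L : vectType F)
    (br : {bilinear L -> L -> L}) : Prop :=
  exists c : nat, lower_central br c = 0%VS.

Definition is_derivation (F : fieldType) (L : vectType F)
    (br : {bilinear L -> L -> L}) (D : {linear L -> L}) : Prop :=
  forall x y, D (br x y) = br (D x) y + br x (D y).

Definition has_order (T : Type) (f : T -> T) (n : nat) : Prop :=
  [/\ (0 < n)%N,
      iter n f =1 id
    & forall m : nat, (0 < m)%N -> iter m f =1 id -> (n <= m)%N].

Definition in_Np (p n : nat) : Prop :=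
  (0 < n)%N /\
  exists (F : fieldType) (L : vectType F) (br : {bilinear L -> L -> L})
         (D : {linear L -> L}),
    [/\ p \in [pchar F],
        is_lie_bracket br,
        ~ lie_nilpotent br,
        is_derivation br D
      & injective D /\ has_order D n].

(* Main.v *)
(* If alpha and all its translates alpha + i (0 <= i < p) are n-th roots of
   unity, then the Lie algebra spanned by x and v_0, ..., v_(p-1), with
   [x, v_i] = v_(i+1) and indices modulo p, is not nilpotent, and x |-> x,
   v_i |-> (alpha + i) v_i is a nonsingular derivation of order dividing n. So
   it suffices to find alpha in F_q such that all alpha + i are nonzero d-th
   powers. With chi a character of order d, the number of points of the curve
   y_i ^ d = x + i (0 <= i < p) is the sum over a in [0, d)^p of the character
   sums S(a) = \sum_x \prod_i chi(x + i) ^ a_i, and the two inequalities leave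
   room for a point with no zero coordinate y_i as soon as Weil's bound
   |S(a) + delta| <= (m - 1 - delta) sqrt q is known for a != 0, where m is the
   number of nonzero a_i and delta = 1 or 0 according to whether d divides the
   sum of the a_i.

   For Weil's bound, the L-function of a is a polynomial \prod_j (1 - w_j T) of
   degree at most m - 1, divisible by 1 - T if delta = 1, and the sums over
   F_(q^r) are - \sum_j w_j ^ r by logarithmic differentiation. Stepanov's
   method bounds them by a constant times q ^ (r / 2) for even r, whence
   |w_j| <= sqrt q. With f = \prod_i (x + i) ^ a_i, and after dividing d and the
   a_i by their common gcd, the auxiliary polynomial of Stepanov's method is
   nonzero because Y ^ d - f(z) / f(x) is irreducible over K(x, z). *)

From HB Require Import structures.
Require Import Defs.
From mathcomp Require Import all_boot all_order all_fingroup all_algebra.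
From mathcomp Require Import all_solvable all_field.
From mathcomp Require Import zify ring lra.
Import Order.TTheory GRing.Theory Num.Theory.
Local Open Scope ring_scope.

Set Implicit Arguments.
Unset Strict Implicit.
Unset Printing Implicit Defensive.

(** * From a solution to a Lie algebra *)

Section CyclicShiftAlgebra.

Variables (F : fieldType) (p' : nat) (alpha omega : F).
Let p := p'.+1.
Let L : vectType F := (F^o * 'rV[F]_p * F^o)%type.

Definition cyc_shift (u : 'rV[F]_p) : 'rV[F]_p := \row_j u 0 (ord_pred j).

(* The triple (a, u, c) stands for a x + \sum_j u_j v_j + c z with
   [x, v_j] = v_(j+1), indices modulo p, and z central; z only serves to give
   the derivation the exact order n. *)
Definition cyc_bracket (x y : L) : L :=
  (0, x.1.1 *: cyc_shift y.1.2 - y.1.1 *: cyc_shift x.1.2, 0).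

Definition cyc_der (x : L) : L :=
  (x.1.1, \row_(j < p) ((alpha + j%:R) * x.1.2 0 j), omega * x.2).

Fact cyc_bracket_bilinear : bilinear_for *:%R *:%R cyc_bracket.
Proof.
split=> [z|z] a x y; congr (_, _, _); rewrite /= ?scaler0 ?addr0 //;
  apply/rowP => j; rewrite !mxE /=;
  case: x y z => [[x1 x2] x3] [[y1 y2] y3] [[z1 z2] z3] /=;
  by rewrite ?mxE /GRing.scale /=; ring.
Qed.

HB.instance Definition _ :=
  bilinear_isBilinear.Build F L L L *:%R *:%R cyc_bracket
    cyc_bracket_bilinear.

Fact cyc_der_linear : linear cyc_der.
Proof.
move=> a x y; congr (_, _, _) => /=.
  by apply/rowP => j; rewrite !mxE /=; ring.
by rewrite mulrDr scalerAr.
Qed.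

HB.instance Definition _ :=
  GRing.isLinear.Build F L L *:%R cyc_der cyc_der_linear.

Lemma cyc_bracket_lie : is_lie_bracket cyc_bracket.
Proof.
split=> [x|x y z]; first by congr (_, _, _); exact: subrr.
congr (_, _, _); rewrite /= ?addr0 //; apply/rowP => j.
by rewrite !mxE /= !mul0r !subr0; rewrite /GRing.scale /=; ring.
Qed.

(** The sum of all the v_j is fixed by ad x, so it survives in every term of the lower central
    series. *)
Lemma cyc_bracket_not_nilpotent : ~ lie_nilpotent cyc_bracket.
Proof.
case=> c lc0; pose v : L := (0, const_mx 1, 0).
have vc : v \in lower_central cyc_bracket c.
  elim: c {lc0} => [|c IHc]; first exact: memvf.
  have -> : v = cyc_bracket (1, 0, 0) v.
    congr (_, _, _); rewrite /= scale0r subr0 scale1r.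
    by apply/rowP => j; rewrite !mxE.
  have /lie_prod_subP :=
    subvv (lie_prod cyc_bracket fullv (lower_central cyc_bracket c)).
  by apply=> //; exact: memvf.
move: vc; rewrite lc0 memv0 => /eqP[/rowP/(_ ord0)/eqP].
by rewrite !mxE oner_eq0.
Qed.

Hypothesis pcharFp : p \in [pchar F].

(** Only the wrap-around at j = 0 needs the characteristic: there the predecessor is p - 1 and p = 0
    in F. *)
Lemma natr_ord_pred (j : 'I_p) : (j%:R : F) = (ord_pred j)%:R + 1.
Proof.
rewrite natr1 -[LHS](GRing.natr_mod_pchar pcharFp) -[RHS](GRing.natr_mod_pchar
  pcharFp).
have -> : ((ord_pred j).+1 %% p = j)%N by rewrite -[RHS]/(nat_of_ord j) -[in
  RHS](ord_predK j).
by rewrite modn_small.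
Qed.

(** The derivation is a grading by weights: x has weight 1 and the weight of v_(j+1) exceeds that of
    v_j by 1, also across the wrap-around. *)
Lemma cyc_der_derivation : is_derivation cyc_bracket cyc_der.
Proof.
move=> x y; congr (_, _, _); rewrite /= ?addr0 ?mulr0 //.
apply/rowP => j; rewrite !mxE /= (natr_ord_pred j).
by rewrite /GRing.scale /=; ring.
Qed.

Variable n : nat.
Hypothesis alpha_n : forall j : nat, (alpha + j%:R) ^+ n = 1.
Hypothesis omega_n : n.-primitive_root omega.

Lemma iter_cyc_der m x : iter m cyc_der x =
  (x.1.1, \row_(j < p) ((alpha + j%:R) ^+ m * x.1.2 0 j), omega ^+ m * x.2).
Proof.
elim: m => [|m /= ->] /=.
  rewrite mul1r; case: x => [[x1 x2] x3] /=; congr (_, _, _).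
  by apply/rowP => j; rewrite !mxE mul1r.
rewrite /cyc_der /=; congr (_, _, _); last by rewrite exprS mulrA.
by apply/rowP => j; rewrite !mxE exprS mulrA.
Qed.

Lemma cyc_in_Np : in_Np p n.
Proof.
have n_gt0 := prim_order_gt0 omega_n.
have iter_n x : iter n cyc_der x = x.
  rewrite iter_cyc_der (prim_expr_order omega_n) mul1r.
  case: x => [[x1 x2] x3] /=; congr (_, _, _).
  by apply/rowP => j; rewrite !mxE alpha_n mul1r.
split=> //; exists F, L, cyc_bracket, cyc_der; split=> //.
- exact: cyc_bracket_lie.
- exact: cyc_bracket_not_nilpotent.
- exact: cyc_der_derivation.
split.
  (* Injectivity comes from D ^ n = id. *)
  by move=> x y exy; rewrite -[x]iter_n -[y]iter_n -(prednK n_gt0) !iterSr exy.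
(* The central element z is scaled by [omega], so D ^ m = id forces n to divide m. *)
split=> // m m_gt0 /(_ (0, 0, 1)); rewrite iter_cyc_der /= => -[_ /eqP].
by rewrite mulr1 -(prim_order_dvd omega_n); exact: dvdn_leq.
Qed.

End CyclicShiftAlgebra.

(** * Independence of powers of f ^ N over K(x)[x ^ Q] *)

Lemma det_expr (R : comNzRingType) n (A : 'M[R]_n.+1) k :
  \det (A ^+ k) = \det A ^+ k.
Proof.
by elim: k => [|k IHk]; rewrite ?expr0 ?det1 // !exprS detM IHk.
Qed.

(* The witness is, up to sign, the constant coefficient of G: the determinant
   of the companion matrix of G. *)
Lemma dvdp_binomial_norm (k : fieldType) (G : {poly k}) d a b :
    (1 < size G)%N -> G %| a *: 'X^d - b%:P ->
  exists D : k, a ^+ (size G).-1 * D ^+ d = b ^+ (size G).-1.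
Proof.
move=> sG Gdiv; have G0 : G != 0 by rewrite -size_poly_gt0 ltnW.
have lG : lead_coef G != 0 by rewrite lead_coef_eq0.
have [H [monH sH Hdiv]] : exists H : {poly k},
    [/\ H \is monic, size H = size G & H %| a *: 'X^d - b%:P].
  exists ((lead_coef G)^-1 *: G).
  by rewrite monicE lead_coefZ mulVf // size_scale ?dvdpZl ?invr_eq0.
rewrite -sH in sG *; move: H monH Hdiv {sH Gdiv lG G0} sG => {}G monG Gdiv sG.
have: exists M : 'M[k]_((size G).-1), char_poly M = G.
  by exists (companionmx G); exact: companionmxK.
case: (size G) sG => [|[|s]] //= _ [M charM]; exists (\det M).
case/dvdpP: Gdiv => r Dr.
(* By Cayley-Hamilton the companion matrix M satisfies a M ^ d = b; determinants then give the
   equation. *)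
have: horner_mx M (a *: 'X^d - b%:P) = 0.
  by rewrite Dr rmorphM /= -charM Cayley_Hamilton mulr0.
rewrite rmorphB /= linearZ /= rmorphXn /= horner_mx_X horner_mx_C.
move/eqP; rewrite subr_eq0 => /eqP/(congr1 determinant).
by rewrite detZ det_expr det_scalar.
Qed.

Lemma fraction_numden (R : idomainType) (x : {fraction R}) :
  exists u v : R, v != 0 /\ x * FracField.tofrac v = FracField.tofrac u.
Proof.
elim/quotW: x => x; exists \n_x, \d_x; split; first exact: denom_ratioP.
apply/eqP; rewrite -[_ * _]/(FracField.mul _ _) !piE FracField.equivfE.
rewrite /FracField.mulf !numden_Ratio ?(oner_eq0, mulf_neq0, denom_ratioP) //.
by rewrite !mulr1 mulrC.
Qed.

(** * Degrees in the inner variable, and the substitution z = x ^ Q *)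

Section BivariateDegree.

Variable K : fieldType.
Implicit Types u v : {poly {poly K}}.

(* The outer variable is z, the inner one x: [inner_deg] bounds the x-degree. *)
Definition inner_deg (s : nat) u := forall j, (size (u`_j)%R <= s.+1)%N.

Lemma inner_degM s t u v :
  inner_deg s u -> inner_deg t v -> inner_deg (s + t) (u * v).
Proof.
move=> su tv j; rewrite coefM; apply: (leq_trans (size_sum _ _ _)).
apply/bigmax_leqP => i _; apply: (leq_trans (size_polyMleq _ _)).
by have := su i; have := tv (j - i)%N; lia.
Qed.

Lemma inner_deg_sum s (I : Type) (r : seq I) (P : pred I) (E : I -> {poly {poly
  K}}) :
  (forall i, P i -> inner_deg s (E i)) -> inner_deg s (\sum_(i <- r | P i) E i).
Proof.
move=> sE; apply: (big_ind (inner_deg s)) => // [j|u v su sv j].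
  by rewrite coef0 size_poly0.
by rewrite coefD (leq_trans (size_polyD _ _)) // geq_max su sv.
Qed.

Lemma inner_deg_prod s (I : finType) (E : I -> {poly {poly K}}) :
  (forall i, inner_deg s (E i)) -> inner_deg (s * #|I|) (\prod_i E i).
Proof.
move=> sE; rewrite cardE -sum1_size big_distrr /= big_enum /=.
elim/big_rec2: _ => [j|i u t _ IH]; last by rewrite muln1; apply: inner_degM.
rewrite (coefC 1); case: eqP => _; rewrite ?size_poly0 //.
by rewrite size_poly1.
Qed.

Lemma inner_deg_det s n (M : 'M[{poly {poly K}}]_n) :
  (forall i j, inner_deg s (M i j)) -> inner_deg (s * n) (\det M).
Proof.
move=> sM; apply: inner_deg_sum => g _ j; rewrite -signr_odd.
have sprod : inner_deg (s * n) (\prod_i M i (g i)).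
  by rewrite -[X in (s * X)%N]card_ord; apply: inner_deg_prod.
by case: odd; rewrite ?mul1r ?expr1 ?mulN1r ?coefN ?size_polyN; apply: sprod.
Qed.

Lemma inner_deg_resultant s (p q : {poly {poly {poly K}}}) :
    (forall i, inner_deg s p`_i) -> (forall i, inner_deg s q`_i) ->
  inner_deg (s * ((size q).-1 + (size p).-1)) (resultant p q).
Proof.
move=> sp sq; apply: inner_deg_det => i j; rewrite Sylvester_mxE.
by case: split => k; case: leq => /=; rewrite ?mulr1n ?mulr0n //;
  move=> l; rewrite coef0 size_poly0.
Qed.

(** Below x-degree Q the substitution z = x ^ Q is a base-Q expansion: the coefficients of distinct
    powers of z occupy disjoint ranges of exponents and cannot cancel. *)
Lemma inner_deg_horner_Xn s Q u :
  inner_deg s u -> (s < Q)%N -> u.['X^Q] = 0 -> u = 0.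
Proof.
elim/poly_ind: u => // u c IHu su ltsQ.
have szc : (size c <= s.+1)%N.
  by have := su 0%N; rewrite coefD coefMX coefC /= add0r.
have{} su : inner_deg s u.
  by move=> j; have := su j.+1; rewrite coefD coefMX coefC /= addr0.
rewrite !hornerE => /eqP; rewrite addr_eq0 => /eqP uc.
have c0 : c = 0.
  apply/polyP => i; rewrite coef0.
  have [/(leq_trans szc)|lti] := leqP s.+1 i; first exact: nth_default.
  by have := congr1 (fun w : {poly K} => w`_i) uc;
    rewrite coefMXn (leq_trans lti) // coefN => /esym/eqP;
      rewrite oppr_eq0 => /eqP.
move/eqP: uc; rewrite c0 oppr0 mulf_eq0 expf_eq0 polyX_eq0 andbF orbF => /eqP.
by move/(IHu su ltsQ)->; rewrite mul0r add0r.
Qed.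

End BivariateDegree.

(** * The resultant argument *)

Section Independence.

Variables (K : fieldType) (f : {poly K}) (d N Q A : nat).
Hypotheses (f_neq0 : f != 0) (d_gt0 : (0 < d)%N) (dN : (d * N).+1 = Q).
Hypothesis fQ : f ^+ Q = f \Po 'X^Q.
(** Equivalently, d and the multiplicities of f at the points of K have gcd 1; this form is the one
    that the argument on orders of vanishing uses. *)
Hypothesis f_mup :
  forall s, (forall x, (d %| s * mup x f)%N) -> (d %| s)%N.

Lemma mup_exp x (u : {poly K}) m : u != 0 -> mup x (u ^+ m) = (m * mup x u)%N.
Proof.
move=> u0; elim: m => [|m IHm];
  first by rewrite mupNroot // rootE hornerC oner_eq0.
by rewrite exprS mupM ?expf_neq0 // IHm mulSn.
Qed.

Lemma size_frob_binomial :
  size (f%:P *: 'X^d - (f^:P)%:P : {poly {poly {poly K}}}) = d.+1.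
Proof.
have fz0 : f^:P != 0 by rewrite map_poly_eq0.
have szX : size (f%:P *: 'X^d : {poly {poly {poly K}}}) = d.+1.
  by rewrite size_scale ?size_polyXn ?polyC_eq0.
by rewrite size_polyDl szX // size_polyN size_polyC fz0.
Qed.

(* A common factor of degree s, 0 < s < d, would make (f(z)/f(x)) ^ s a d-th
   power in K(x, z); the orders of vanishing at the zeros of f forbid it. *)
Lemma no_common_factor (p : {poly {poly {poly K}}}) :
  (0 < size p <= d)%N -> resultant p (f%:P *: 'X^d - (f^:P)%:P) != 0.
Proof.
set fz := f^:P; set q := f%:P *: _ - _; move=> /andP[p_gt0 szp].
(* Over the fraction field of K[x, z] a zero resultant amounts to a nontrivial gcd. *)
pose phi : {rmorphism {poly {poly K}} -> {fraction {poly {poly K}}}} :=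
  @FracField.tofrac {poly {poly K}}.
have phi_eq0 u : (phi u == 0) = (u == 0) by exact: tofrac_eq0.
have p0 : p != 0 by rewrite -size_poly_gt0.
have fP0 : f%:P != 0 :> {poly {poly K}} by rewrite polyC_eq0.
have fz0 : fz != 0 by rewrite map_poly_eq0.
have szq : size q = d.+1 by exact: size_frob_binomial.
have q0 : q != 0 by rewrite -size_poly_gt0 szq.
rewrite -phi_eq0 (map_resultant (f := phi)) ?phi_eq0 ?lead_coef_eq0 //.
rewrite resultant_eq0 -leqNgt leqNgt; apply/negP => szG.
set G := gcdp _ _ in szG.
have Gq : G %| phi f%:P *: 'X^d - (phi fz)%:P.
  apply: dvdp_trans (dvdp_gcdr _ _) _.
  by rewrite rmorphB /= map_polyZ map_polyXn map_polyC dvdpp.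
have [D] := dvdp_binomial_norm szG Gq.
have szGd : ((size G).-1 < d)%N.
  have : (size G <= size p)%N.
    rewrite -(size_map_poly_id0 (f := phi)) ?phi_eq0 ?lead_coef_eq0 //.
    by apply: dvdp_leq (dvdp_gcdl _ _);
      rewrite map_poly_eq0_id0 ?phi_eq0 ?lead_coef_eq0.
  lia.
have s_gt0 : (0 < (size G).-1)%N by lia.
move: (size G).-1 szGd s_gt0 => s s_lt s_gt0 eqD.
have [u [v [v0 Duv]]] := fraction_numden D.
have {eqD} : f%:P ^+ s * u ^+ d = fz ^+ s * v ^+ d.
  have phi_inj : injective phi by move=> x y /eqP;
    rewrite -subr_eq0 -rmorphB phi_eq0 subr_eq0 => /eqP.
  apply: phi_inj; rewrite !rmorphM !rmorphXn /=.
  by rewrite -[phi u]Duv exprMn mulrA eqD.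
(* The equation is f(x) ^ s u ^ d = f(z) ^ s v ^ d. Leading coefficients in z turn f(z) into a
   nonzero constant and leave an equation in K[x], where multiplicities can be compared modulo d. *)
move/(congr1 lead_coef); rewrite !lead_coefM !lead_coef_exp lead_coefC.
have -> : lead_coef fz = (lead_coef f)%:P by rewrite lead_coef_map_inj //;
  exact: polyC_inj.
set U := lead_coef u; set V := lead_coef v => eqUV.
have V0 : V != 0 by rewrite lead_coef_eq0.
have lf0 : lead_coef f != 0 by rewrite lead_coef_eq0.
have U0 : U != 0.
  apply/eqP => U0; move/eqP: eqUV;
    rewrite U0 expr0n -[in d == _](prednK d_gt0) mulr0 eq_sym.
  by rewrite mulf_eq0 !expf_eq0 polyC_eq0 (negPf V0) (negPf lf0) !andbF.
have /f_mup : forall x, (d %| s * mup x f)%N.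
  move=> x; move/(congr1 (mup x)): eqUV; rewrite -polyC_exp.
  rewrite !mupM ?mup_exp ?expf_neq0 ?polyC_eq0 ?expf_neq0 //.
  rewrite [mup x _%:P]mupNroot; last by rewrite rootC expf_neq0.
  rewrite add0n => eqs.
  have := dvdn_addl (s * mup x f) (dvdn_mulr (mup x U) (dvdnn d)).
  by rewrite eqs dvdn_mulr // => <-.
by move/(dvdn_leq s_gt0); rewrite leqNgt s_lt.
Qed.

(** At z = x ^ Q, the element f ^ N is a common root in Y of \sum_i k_i Y ^ i and of f(x) Y ^ d -
    f(z), because f ^ (d N + 1) = f ^ Q = f(x ^ Q). Hence their resultant vanishes at z = x ^ Q; its
    small x-degree makes it zero, against [no_common_factor]. *)
Lemma frobenius_independence (k : nat -> {poly {poly K}}) :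
    (forall i j, (size ((k i)`_j)%R <= A)%N) -> (size f <= A)%N -> (2 * d * A
      <= Q)%N ->
    \sum_(i < d) (k i).['X^Q] * f ^+ (N * i) = 0 ->
  forall i, (i < d)%N -> k i = 0.
Proof.
move=> szk szf leAQ sum0.
have A_gt0 : (0 < A)%N by apply: leq_trans szf; rewrite size_poly_gt0.
pose p : {poly {poly {poly K}}} := \poly_(i < d) k i.
suff p0 : p = 0.
  move=> i ltid; have := congr1 (fun w : {poly {poly {poly K}}} => w`_i) p0.
  by rewrite coef_poly ltid coef0.
apply/eqP/negPn/negP => p0.
pose q : {poly {poly {poly K}}} := (f%:P) *: 'X^d - (f^:P)%:P.
have szp : (0 < size p <= d)%N by rewrite size_poly_gt0 p0 size_poly.
have /eqP := no_common_factor szp; apply; rewrite -/q.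
have szq : size q = d.+1 by exact: size_frob_binomial.
have degp i : inner_deg A.-1 p`_i.
  by move=> j; rewrite coef_poly; case: ifP => _;
    rewrite ?coef0 ?size_poly0 ?prednK.
have degq i : inner_deg A.-1 q`_i.
  move=> j; rewrite coefB coefZ coefXn coefC coefB prednK //.
  apply: leq_trans (size_polyD _ _) _; rewrite geq_max size_polyN; apply/andP;
    split.
    case: (i == d); last by rewrite mulr0 coef0 size_poly0.
    by rewrite mulr1 coefC; case: ifP; rewrite ?size_poly0.
  case: (i == 0%N); last by rewrite coef0 size_poly0.
  by rewrite coef_map_id0 //; apply: leq_trans (size_polyC_leq1 _) _.
(* The Sylvester matrix has at most 2 d - 1 rows with entries of x-degree at most A - 1, so the
   resultant has x-degree below 2 d A <= Q. *)
apply: (inner_deg_horner_Xn (inner_deg_resultant degp degq) (Q := Q)).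
  move: szp szq leAQ A_gt0 => /andP[_]; nia.
pose ev (u : {poly {poly {poly K}}}) := (map_poly (horner_eval 'X^Q) u).[f ^+
  N].
have evp : ev p = 0.
  rewrite /ev -[RHS]sum0; have := size_poly d k; rewrite -/p => szpd.
  rewrite (horner_coef_wide _ (leq_trans (size_poly _ _) szpd)).
  apply: eq_bigr => i _; rewrite coef_map /= coef_poly ltn_ord /horner_eval.
  by rewrite -exprM.
have evq : ev q = 0.
  rewrite /ev rmorphB /= map_polyZ map_polyXn map_polyC /= !hornerE
    /horner_eval.
  rewrite hornerC -exprM mulnC -exprS dN fQ.
  by rewrite /comp_poly subrr.
(* The resultant is a combination of p and q only when both have positive degree in Y; a constant p
   is treated directly. *)
have [szp1|szp1] := leqP (size p) 1.
  move: evp; rewrite /ev (size1_polyC szp1) map_polyC hornerC => p00.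
  move/eqP: p0; rewrite (size1_polyC szp1).
  rewrite [p`_0](inner_deg_horner_Xn (degp 0%N) _ p00) //; nia.
have szq1 : (1 < size q)%N by rewrite szq.
have [[U V] _ /= Dres] := resultant_in_ideal szp1 szq1.
have : ev (resultant p q)%:P = 0.
  by rewrite Dres /ev rmorphD !rmorphM /= hornerD !hornerM -!/(ev _) evp evq
    !mulr0 addr0.
by rewrite /ev map_polyC hornerC /horner_eval.
Qed.

End Independence.

(** * Stepanov's method *)

Section HasseDerivatives.

Variable K : fieldType.
Implicit Types (u v f w : {poly K}).

(** Leibniz's rule; divided derivatives absorb the binomial coefficients. *)
Lemma nderivnM n u v :
  (u * v)^`N(n) = \sum_(i < n.+1) u^`N(i) * v^`N(n - i).
Proof.
have nderivnMX w m : (w * 'X)^`N(m.+1) = w^`N(m) + w^`N(m.+1) * 'X.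
  by rewrite -[w * 'X]addr0 -(polyC0 K) nderivnMXaddC.
elim/poly_ind: u v n => [v n|u c IHu v n].
  rewrite mul0r -{1}(polyC0 K) nderivnC if_same big1 // => i _.
  by rewrite -(polyC0 K) nderivnC if_same polyC0 mul0r.
rewrite mulrDl -mulrA ['X * v]mulrC mulrA nderivnD mul_polyC nderivnZ.
case: n => [|n].
  rewrite big_ord_recl big_ord0 addr0 !nderivn0 mulrDl -mul_polyC.
  by rewrite -mulrA [v * _]mulrC mulrA.
rewrite nderivnMX !IHu [RHS]big_ord_recl /= nderivn0 subn0.
rewrite [X in _ = _ + X](eq_bigr (fun i : 'I_n.+1 =>
  u^`N(i) * v^`N(n - i) + u^`N(i.+1) * v^`N(n - i) * 'X)); last first.
  by move=> i _; rewrite /bump /= add1n nderivnMXaddC mulrDl subSS mulrAC.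
rewrite big_split /= -mulr_suml [X in _ + X * 'X + _]big_ord_recl nderivn0
  subn0.
rewrite [X in _ + (_ + X) * 'X + _](eq_bigr (fun i : 'I_n.+1 =>
  u^`N(i.+1) * v^`N(n - i))); last first.
  by move=> i _; rewrite lift0 subSS.
by rewrite -mul_polyC; ring.
Qed.

(** By Taylor expansion at x, which with divided derivatives is valid in every characteristic;
    ordinary derivatives would miss multiplicities of p and more. *)
Lemma dvdp_nderiv u x M :
  (forall l, (l < M)%N -> (u^`N(l)).[x] = 0) -> ('X - x%:P) ^+ M %| u.
Proof.
move=> u0; have -> : u = u^:P.[x%:P + ('X - x%:P)].
  by rewrite [x%:P + _]addrC subrK -[u^:P.['X]]/(u \Po 'X) comp_polyXr.
rewrite nderiv_taylor; last exact: mulrC.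
apply: (big_ind (fun w => _ %| w)) => [|v w|i _];
  [exact: dvdp0|exact: dvdp_add|].
have [ltiM|leMi] := ltnP i M; last by rewrite dvdp_mull ?dvdp_exp2l.
by rewrite nderivn_map horner_map /= u0 // polyC0 mul0r dvdp0.
Qed.

(* [nderiv_rem f e l] is f ^ l (f ^ e)^(l) / f ^ e, of degree at most l deg f. *)
Fixpoint nderiv_rem f (e l : nat) {struct e} : {poly K} :=
  if e is e'.+1 then
    nderiv_rem f e' l +
    \sum_(i < l) f ^+ i * f^`N(i.+1) * nderiv_rem f e' (l - i.+1)
  else (l == 0%N)%:R.

Lemma nderiv_remE f e l : f ^+ l * (f ^+ e)^`N(l) = f ^+ e * nderiv_rem f e l.
Proof.
elim: e l => [|e IHe] l.
  rewrite expr0 mul1r /= -[1](polyC1 K) nderivnC.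
  by case: l => [|l] /=; rewrite ?mulr1 ?expr0 ?polyC1 // mulr0.
rewrite exprS nderivnM mulr_sumr big_ord_recl nderivn0 subn0 /= mulrDr mulrCA
  IHe.
rewrite mulrA; congr (_ + _); rewrite mulr_sumr; apply: eq_bigr => i _.
rewrite /bump /= add1n.
have -> : f ^+ l = f * f ^+ i * f ^+ (l - i.+1).
  by rewrite -exprS -exprD subnKC.
transitivity (f * f ^+ i * f^`N(i.+1) * (f ^+ (l - i.+1) * (f ^+ e)^`N(l -
  i.+1))).
  by rewrite -!mulrA; congr (_ * (_ * _)); rewrite mulrCA.
by rewrite IHe; ring.
Qed.

Lemma size_nderivn f n : (size f^`N(n) <= size f)%N.
Proof. exact: leq_trans (size_poly _ _) (leq_subr _ _). Qed.

End HasseDerivatives.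

Section LinearSystem.

Lemma underdetermined (K : fieldType) (I : finType) n (v : I -> 'rV[K]_n) :
    (n < #|I|)%N ->
  exists2 kappa : I -> K, exists i, kappa i != 0 & \sum_i kappa i *: v i = 0.
Proof.
move=> ltnI; pose M := \matrix_(i < #|I|) v (enum_val i).
have : kermx M != 0.
  rewrite kermx_eq0 /row_free; apply: contraTneq ltnI => <-.
  by rewrite -leqNgt rank_leq_col.
case/rowV0Pn => w /sub_kermxP wM /rV0Pn[i wi0].
exists (fun j => w 0 (enum_rank j)); first by exists (enum_val i);
  rewrite enum_valK.
rewrite -[RHS]wM mulmx_sum_row (reindex (@enum_val I predT)) /=;
  last exact/onW_bij/enum_val_bij.
by apply: eq_bigr => j _; rewrite enum_valK rowK.
Qed.

Lemma size_multiple_roots (K : fieldType) (h : {poly K}) M (Z : seq K) :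
    uniq Z -> h != 0 -> (forall x, x \in Z -> ('X - x%:P) ^+ M %| h) ->
  (M * size Z < size h)%N.
Proof.
move=> uZ h0 divh.
have : \prod_(x <- Z) ('X - x%:P) ^+ M %| h.
  elim: Z uZ divh => [|x Z IHZ] /=; first by rewrite big_nil dvd1p.
  case/andP=> xZ uZ divh; rewrite big_cons Gauss_dvdp.
    rewrite divh ?mem_head //= IHZ // => y yZ; apply: divh.
    by rewrite in_cons yZ orbT.
  rewrite coprimep_expl // coprimep_sym coprimep_XsubC prodrXl rootE hornerE.
  rewrite expf_eq0 negb_and orbC -rootE root_prod_XsubC.
  by rewrite xZ.
rewrite prodrXl; move/(dvdp_leq h0); apply: leq_trans.
rewrite [X in (_ < X)%N]polySpred ?expf_neq0 ?monic_neq0 ?monic_prod_XsubC //.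
by rewrite size_exp size_prod_XsubC mulnC.
Qed.

End LinearSystem.

Lemma exprB_pchar (R : comNzRingType) (x y : R) n :
  [pchar R].-nat n -> (x - y) ^+ n = x ^+ n - y ^+ n.
Proof. by move=> nP; apply/esym/eqP;
  rewrite subr_eq -exprDn_pchar // subrK. Qed.

Section StepanovRemainders.

Variables (K : fieldType) (f : {poly K}).
Let D := (size f).-1.

Lemma size_nderiv_rem e l : (size (nderiv_rem f e l) <= (l * D).+1)%N.
Proof.
elim: e l => [|e IHe] l /=.
  by case: (l == 0%N); rewrite ?size_poly1 ?size_poly0.
apply: leq_trans (size_polyD _ _) _; rewrite geq_max IHe /=.
apply: leq_trans (size_sum _ _ _) _; apply/bigmax_leqP => i _.
apply: leq_trans (size_polyMleq _ _) _.
have := size_polyMleq (f ^+ i) f^`N(i.+1); have := IHe (l - i.+1)%N.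
have := size_poly_exp_leq f i; have := size_nderivn f i.+1.
have := leqSpred (size f); rewrite -/D; have := ltn_ord i.
have -> : (l * D = D * i + D + (l - i.+1) * D)%N.
  rewrite -{1}(subnKC (ltn_ord i)); ring.
lia.
Qed.

(** The analogous cofactor f ^ l (f ^ e x ^ a)^(l) / f ^ e, of degree at most l deg f + a. *)
Definition nderiv_mul_rem e l a : {poly K} :=
  \sum_(i < l.+1) nderiv_rem f e i * (f ^+ (l - i) * ('X^a)^`N(l - i)).

Lemma nderiv_mul_remE e l a :
  f ^+ l * (f ^+ e * 'X^a)^`N(l) = f ^+ e * nderiv_mul_rem e l a.
Proof.
rewrite nderivnM !mulr_sumr; apply: eq_bigr => i _.
rewrite mulrA [in RHS]mulrA -nderiv_remE.
have -> : f ^+ l = f ^+ i * f ^+ (l - i) by rewrite -exprD subnKC // -ltnS.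
by ring.
Qed.

Lemma size_nderiv_mul_rem e l a :
  (size (nderiv_mul_rem e l a) <= (l * D + a).+1)%N.
Proof.
apply: leq_trans (size_sum _ _ _) _; apply/bigmax_leqP => i _.
apply: leq_trans (size_polyMleq _ _) _.
have := size_polyMleq (f ^+ (l - i)) ('X^a)^`N(l - i).
have := size_nderiv_rem e i; have := size_poly_exp_leq f (l - i).
have := size_nderivn ('X^a : {poly K}) (l - i); rewrite size_polyXn -/D.
have : (i <= l)%N by rewrite -ltnS.
move=> leil; have -> : (l * D = D * (l - i) + i * D)%N.
  by rewrite -{1}(subnKC leil); ring.
lia.
Qed.

End StepanovRemainders.

(** * The auxiliary polynomial and the bound on the fibres *)

Section Stepanov.

Variables (K : fieldType) (p : nat) (pcharKp : p \in [pchar K]).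
Variables (f : {poly K}) (k d N m : nat).
Let Q := (m * m)%N.
Let D := (size f).-1.
Hypotheses (Qpk : Q = (p ^ k)%N) (f_neq0 : f != 0) (d_gt0 : (0 < d)%N).
Hypothesis dN : (d * N).+1 = Q.
Hypothesis fQ : f ^+ Q = f \Po 'X^Q.
Hypothesis f_mup :
  forall s, (forall x, (d %| s * mup x f)%N) -> (d %| s)%N.
Let C := (4 * d * (d * D + 3))%N.
Hypothesis lemC : (C <= m)%N.
Variables (c : K) (Z : seq K).
Hypotheses (c_neq0 : c != 0) (uZ : uniq Z).
Hypothesis ZQ : forall x, x \in Z -> x ^+ Q = x /\ f.[x] ^+ N = c.

(** The auxiliary polynomial combines the x ^ l f ^ (N i) x ^ (j Q) with i < d, j < J and l < A. It
    is to vanish to order M on Z, and W bounds the number of coefficients of each of the M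
    conditions. *)
Let J := (m + C)%N.
Let A := (Q %/ (2 * d))%N.
Let M := (d * m)%N.
Let W := (A + M * D + J)%N.

(** The last inequality leaves more unknowns than equations. The terms d m A cancel on both sides;
    what remains is m ^ 2 d D + m (m + C) < C A, which follows from C A >= Q (d D + 3) and C <=
    m. *)
Lemma stepanov_sizes :
  [/\ (size f <= A)%N, (2 * d * A <= Q)%N, (M <= Q)%N, (0 < m)%N
    & (M * W < d * J * A)%N].
Proof.
have m_gt0 : (0 < m)%N by apply: leq_trans lemC; rewrite /C; nia.
have le2dA : (2 * d * A <= Q)%N by rewrite mulnC leq_trunc_div.
have ge2dA : (Q < 2 * d * A.+1)%N by rewrite [X in (_ < X)%N]mulnC ltn_ceil;
  lia.
have d12m : (12 * d <= m)%N by apply: leq_trans lemC; rewrite /C; nia.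
have ge4dA : (Q <= 4 * d * A)%N by rewrite /Q in ge2dA le2dA *; nia.
have A_ge : (m * (d * D + 3) <= A)%N.
  have : (4 * d * (m * (d * D + 3)) <= 4 * d * A)%N.
    apply: leq_trans ge4dA; rewrite /Q.
    by rewrite mulnCA leq_mul2l lemC orbT.
  by rewrite leq_mul2l => /orP[|//]; lia.
have szf : (size f = D.+1)%N by rewrite prednK // size_poly_gt0.
split => //.
- rewrite szf; nia.
- rewrite /M /Q leq_mul2r; lia.
rewrite /W /M /J.
have CA : (Q * (d * D + 3) <= C * A)%N.
  by rewrite /C mulnAC [(Q * _)%N]mulnC [X in (_ <= X)%N]mulnC leq_mul2l ge4dA
    orbT.
have -> : (d * (m + C) * A = d * m * A + d * (C * A))%N by ring.
have -> : (d * m * (A + d * m * D + (m + C)) =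
  d * m * A + d * (m * (d * m * D + (m + C))))%N by ring.
rewrite ltn_add2l ltn_pmul2l //; apply: leq_trans CA; rewrite /Q.
have -> : (m * (d * m * D + (m + C)) = m * m * (d * D) + m * (m + C))%N by ring.
have mC : (m * (m + C) < m * m * 3)%N by nia.
by rewrite [X in (_ < X)%N]mulnDr ltn_add2l.
Qed.

Let I : finType := ('I_d * 'I_J * 'I_A)%type.
Let aux_mon (i : I) : {poly K} := 'X^(i.2) * f ^+ (N * i.1.1).

(* For x in Z, f(x) ^ N = c and x ^ Q = x turn the vanishing at x of the l-th
   Hasse derivative of the auxiliary polynomial into that of the polynomial
   below, which does not depend on x; we ask for it to be zero. *)
Lemma stepanov_system : exists2 kappa : I -> K, exists i, kappa i != 0 &
  forall l, (l < M)%N ->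
  \sum_i kappa i *: (c ^+ i.1.1 *: 'X^(i.1.2) * nderiv_mul_rem f (N * i.1.1) l
    i.2) = 0.
Proof.
have [_ _ _ _ ltMW] := stepanov_sizes.
pose cond (i : I) (l : nat) : {poly K} :=
  c ^+ i.1.1 *: 'X^(i.1.2) * nderiv_mul_rem f (N * i.1.1) l i.2.
pose v (i : I) : 'rV[K]_(M * W) := mxvec (\matrix_(l < M, w < W) (cond i l)`_w).
have [|kappa nzk kv] := @underdetermined K I _ v.
  by rewrite !card_prod !card_ord.
exists kappa => // l ltlM; apply/polyP => w; rewrite coef0.
have szcond i : (size (cond i l) <= W)%N.
  rewrite /cond -scalerAl; apply: leq_trans (size_scale_leq _ _) _.
  apply: leq_trans (size_polyMleq _ _) _; rewrite size_polyXn.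
  have := size_nderiv_mul_rem f (N * i.1.1) l i.2; rewrite -/D.
  have := ltn_ord i.1.2; have := ltn_ord i.2; rewrite /W.
  have : (l * D <= M * D)%N by rewrite leq_mul2r ltnW ?orbT.
  lia.
have [leWw|ltwW] := leqP W w.
  rewrite nth_default // (leq_trans _ leWw) // (leq_trans (size_sum _ _ _)) //.
  by apply/bigmax_leqP => i _; apply: leq_trans (size_scale_leq _ _) (szcond i).
have := congr1 (fun u : 'rV[K]_(M * W) => vec_mx u (Ordinal ltlM) (Ordinal
  ltwW)) kv.
rewrite /= linear_sum linear0 summxE mxE => kvE; rewrite coef_sum -[RHS]kvE.
by apply: eq_bigr => i _; rewrite linearZ /= mxvecK !mxE coefZ.
Qed.

(** The auxiliary polynomial h is nonzero by [frobenius_independence] and vanishes to order M = d m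
    at each point of Z; comparing with its degree and dividing by m gives the bound. *)
Lemma stepanov_bound : (d * size Z <= Q + (C + D + 1) * m)%N.
Proof.
have [szfA leAQ leMQ m_gt0 _] := stepanov_sizes.
have [kappa [i0 nzk] Dk] := stepanov_system.
pose h := \sum_i kappa i *: (aux_mon i * 'X^(i.1.2 * Q)).
have Q_gt0 : (0 < Q)%N by rewrite /Q muln_gt0 m_gt0.
have h_neq0 : h != 0.
  apply: contraNneq nzk => h0.
  (* Group h by the powers of f ^ N, with an outer variable z in place of x ^ Q. *)
  pose kk (i : nat) : {poly {poly K}} := \sum_(i' : I | i'.1.1 == i :> nat)
    (kappa i' *: 'X^(i'.2))%:P * 'X^(i'.1.2).
  have kkE (i : 'I_d) j l (ltj : (j < J)%N) (ltl : (l < A)%N) :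
      (kk i)`_j`_l = kappa (i, Ordinal ltj, Ordinal ltl).
    rewrite !coef_sum (bigD1 (i, Ordinal ltj, Ordinal ltl)) //=.
    rewrite coefMXn ltnn subnn coefC /= coefZ coefXn eqxx mulr1 big1 ?addr0 //.
    case=> [[i1 j1] l1] /andP[/= /eqP/val_inj -> neq].
    rewrite coefMXn; case: ltnP => [_|lej]; first by rewrite coef0.
    rewrite coefC subn_eq0; case: leqP => [lej'|_]; last by rewrite coef0.
    rewrite coefZ coefXn; case: eqP => [ell|_]; last by rewrite mulr0.
    case/negP: neq; apply/eqP; congr (_, _, _); apply: val_inj => //=.
    by apply/eqP; rewrite eqn_leq lej lej'.
  have szkk i j : (size ((kk i)`_j)%R <= A)%N.
    rewrite coef_sum; apply: leq_trans (size_sum _ _ _) _;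
      apply/bigmax_leqP => i' _.
    rewrite coefMXn; case: ifP => _; rewrite ?size_poly0 // coefC.
    case: ifP => _; rewrite ?size_poly0 // (leq_trans (size_scale_leq _ _)) //.
    by rewrite size_polyXn.
  have kk0 : \sum_(i < d) (kk i).['X^Q] * f ^+ (N * i) = 0.
    rewrite -[RHS]h0 [RHS](partition_big (fun i : I => i.1.1) predT) //=.
    apply: eq_bigr => i _; rewrite /kk horner_sum mulr_suml.
    apply: eq_big => [i'|i' eqi] //.
    rewrite hornerM hornerXn hornerC -exprM mulnC /aux_mon (eqP eqi) -!scalerAl.
    by congr (_ *: _); rewrite -mulrA [_ * 'X^(_ * _)]mulrC mulrA mulrAC.
  have := frobenius_independence f_neq0 d_gt0 dN fQ f_mup szkk szfA leAQ kk0
    (ltn_ord i0.1.1).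
  move/(congr1 (fun u : {poly {poly K}} => u`_(i0.1.2)`_(i0.2))).
  rewrite kkE /= !coef0; move: i0 => [[i j] l] /=.
  by move=> <-; apply/eqP; congr (kappa (_, _, _)); apply: val_inj.
have multh x : x \in Z -> ('X - x%:P) ^+ M %| h.
  move=> Zx; have [xQ fxN] := ZQ Zx.
  have fx0 : f.[x] != 0.
    have N_neq0 : N != 0%N.
      apply: contraTneq leMQ => N0; rewrite -dN N0 muln0 /M -ltnNge.
      have := lemC; rewrite /C; nia.
    apply: contraNneq c_neq0 => fx0.
    by rewrite -fxN fx0 expr0n (negPf N_neq0).
  (* As x ^ Q = x, the difference X ^ (j Q) - x ^ j equals (X ^ j - x ^ j) ^ Q, divisible by (X - x)
     ^ Q. Since M <= Q, the powers of X ^ Q may be replaced by constants, and only f ^ (N i) X ^ l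
     remains to be differentiated. *)
  pose hx := \sum_i (kappa i * x ^+ i.1.2) *: aux_mon i.
  have hhx : ('X - x%:P) ^+ Q %| h - hx.
    rewrite -sumrB; apply: (big_ind (fun w => _ %| w)) => [|u w|i _].
    - exact: dvdp0.
    - exact: dvdp_add.
    rewrite -scalerA -scalerBr -mul_polyC dvdp_mull //.
    have -> : aux_mon i * 'X^(i.1.2 * Q) - x ^+ i.1.2 *: aux_mon i =
        aux_mon i * ('X^(i.1.2) - (x ^+ i.1.2)%:P) ^+ Q.
      rewrite -mul_polyC [_%:P * _]mulrC -mulrBr; congr (_ * _).
      have pcharP : [pchar {poly K}].-nat Q.
        rewrite Qpk pnatX; apply/orP; left.
        by rewrite (eq_pnat _ (pchar_poly K)) pnatE ?(pcharf_prime pcharKp).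
      rewrite [RHS](exprB_pchar _ _ pcharP) exprM.
      by rewrite -polyC_exp -(exprM x) mulnC exprM xQ.
    rewrite dvdp_mull // dvdp_exp2r // polyC_exp subrXX dvdp_mulr //.
  have hxM : ('X - x%:P) ^+ M %| hx.
    apply: dvdp_nderiv => l ltlM.
    apply: (mulfI (expf_neq0 l fx0)); rewrite mulr0 -horner_exp -hornerM.
    have := congr1 (fun w : {poly K} => w.[x]) (Dk l ltlM).
    rewrite horner0 /= !horner_sum => <-.
    rewrite (raddf_sum (nderivn l)) /= mulr_sumr horner_sum;
      apply: eq_bigr => i _.
    rewrite nderivnZ -scalerAr /aux_mon ['X^(i.2) * _]mulrC nderiv_mul_remE
      !(hornerZ, hornerM, hornerXn, horner_exp).
    rewrite exprM fxN; ring.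
  by rewrite -[h](subrK hx) dvdp_add // (dvdp_trans _ hhx) // dvdp_exp2l.
have := size_multiple_roots uZ h_neq0 multh.
have szh : (size h <= A + Q * D + J * Q)%N.
  apply: leq_trans (size_sum _ _ _) _; apply/bigmax_leqP => i _.
  apply: leq_trans (size_scale_leq _ _) _.
  apply: leq_trans (size_polyMleq _ _) _; rewrite size_polyXn addnS /=.
  have := size_polyMleq ('X^(i.2) : {poly K}) (f ^+ (N * i.1.1)).
  rewrite size_polyXn /= -/(aux_mon i); have := size_poly_exp_leq f (N * i.1.1).
  rewrite -/D; have lti2 := ltn_ord i.2.
  have : (D * (N * i.1.1) <= Q * D)%N.
    rewrite mulnC leq_mul2r -dN [(d * N)%N]mulnC (leq_trans _ (leqnSn _)) ?orbT
      //.
    by rewrite leq_mul2l ltnW ?orbT.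
  have : (i.1.2 * Q <= J * Q)%N by rewrite leq_mul2r ltnW ?orbT.
  move=> lejQ leD lef leaux; rewrite leq_add //; apply: leq_trans leaux _.
  by apply: leq_trans (leq_add (leqnn _) lef) _; rewrite addnS -addSn leq_add.
move=> /leq_trans/(_ szh) ltMZ.
have leAQ1 : (A <= Q)%N by exact: leq_div.
rewrite -(leq_pmul2l m_gt0) mulnA [(m * d)%N]mulnC -/M.
apply: (leq_trans (ltnW ltMZ)).
have -> : (m * (Q + (C + D + 1) * m) = Q + Q * D + J * Q)%N by rewrite /J /Q;
  ring.
by rewrite -addnA -[X in (_ <= X)%N]addnA leq_add2r.
Qed.

End Stepanov.

(** * L-functions of products of multiplicative characters *)

Section PolynomialsOverFiniteField.

Variable F : finFieldType.
Implicit Types g h : {poly F}.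

Fixpoint polys_lt (j : nat) : seq {poly F} :=
  if j is j'.+1 then [seq g + c *: 'X^j' | g <- polys_lt j', c <- enum F]
  else [:: 0].

Definition monics (j : nat) : seq {poly F} := [seq 'X^j + g | g <- polys_lt j].

Lemma mem_polys_lt j g : (g \in polys_lt j) = (size g <= j)%N.
Proof.
elim: j g => [|j IHj] g; first by rewrite inE leqn0 size_poly_eq0.
apply/allpairsP/idP => [[[h c] /= [hj _ ->]]|sg].
  rewrite IHj in hj; apply: leq_trans (size_polyD _ _) _.
  rewrite geq_max (leq_trans hj) //= (leq_trans (size_scale_leq _ _)) //.
  by rewrite size_polyXn.
exists (g - g`_j *: 'X^j, g`_j); split; rewrite ?mem_enum //=;
  last by rewrite subrK.
rewrite IHj; apply/leq_sizeP => i; rewrite leq_eqVlt coefB coefZ coefXn eq_sym.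
case: eqP => [-> _|_ /= ltji]; first by rewrite mulr1 subrr.
by rewrite mulr0 subr0 nth_default // (leq_trans sg).
Qed.

Lemma uniq_polys_lt j : uniq (polys_lt j).
Proof.
elim: j => //= j IHj; apply: allpairs_uniq => //; first exact: enum_uniq.
have coefj g c : (size g <= j)%N -> (g + c *: 'X^j)`_j = c.
  by move=> sg; rewrite coefD coefZ coefXn eqxx mulr1 nth_default ?add0r.
move=> [g c] [h c'] /allpairsP[[g1 c1] /= [gj _ [-> ->]]].
case/allpairsP=> [[h1 c2] /= [hj _ [-> ->]]] eqgh.
rewrite !mem_polys_lt in gj hj.
have ecc : c1 = c2 by rewrite -(coefj g1 c1 gj) -(coefj h1 c2 hj) eqgh.
by move: eqgh; rewrite ecc => /addIr ->.
Qed.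

Lemma mem_monics j g : (g \in monics j) = (g \is monic) && (size g == j.+1).
Proof.
apply/mapP/andP => [[h]|[mong /eqP sg]].
  rewrite mem_polys_lt => sh ->.
  have szX : size ('X^j + h) = j.+1 by rewrite size_polyDl size_polyXn // ltnS.
  split; last exact/eqP.
  by rewrite monicE lead_coefDl ?lead_coefXn // size_polyXn ltnS.
exists (g - 'X^j); last by rewrite addrC subrK.
rewrite mem_polys_lt; apply/leq_sizeP => i;
  rewrite leq_eqVlt coefB coefXn eq_sym.
case: eqP => [-> _|_ /= ltji]; last by rewrite subr0 nth_default // sg.
by apply/eqP; rewrite subr_eq0 -(eqP mong) lead_coefE sg.
Qed.

Lemma uniq_monics j : uniq (monics j).
Proof. by rewrite map_inj_uniq ?uniq_polys_lt //; exact: addrI. Qed.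

Section CharacterSums.

Variables (chi : F -> algC) (A : {set F}) (a : F -> nat).
Hypotheses (chi1 : chi 1 = 1) (chi0 : chi 0 = 0).
Hypothesis chiM : {morph chi : x y / x * y}.
Hypothesis a_gt0 : forall u, u \in A -> (0 < a u)%N.
Hypothesis chi_sum : forall u, u \in A -> \sum_c chi c ^+ a u = 0.

(** A Dirichlet character on F[x] modulo the product of the X - u, u in A; [Lcoef j] is then the
    coefficient of T ^ j in its L-function. *)
Definition poly_char g : algC := \prod_(u in A) chi g.[u] ^+ a u.

Definition Lcoef j : algC := \sum_(g <- monics j) poly_char g.

Lemma poly_charM g h : poly_char (g * h) = poly_char g * poly_char h.
Proof.
by rewrite -big_split; apply: eq_bigr => u _ /=; rewrite hornerM chiM exprMn.
Qed.

(* Adding multiples of the product of the X - u, u != u0, only moves the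
   value at u0, over which the character averages to zero. *)
Lemma sum_poly_char_coset h j : (0 < #|A| <= j)%N ->
  \sum_(g <- polys_lt j) poly_char (h + g) = 0.
Proof.
case/andP=> /card_gt0P[u0 Au0] leAj; set S := \sum_(g <- _) _.
pose G := \prod_(u in A :\ u0) ('X - u%:P).
have szG : size G = #|A|.
  by rewrite /G -big_enum size_prod_XsubC -cardE (cardsD1 u0 A) Au0.
have G0 : G.[u0] != 0.
  rewrite horner_prod; apply/prodf_neq0 => u; rewrite !inE => /andP[nu _].
  by rewrite !hornerE subr_eq0 eq_sym.
have Gu u : u \in A -> u != u0 -> G.[u] = 0.
  move=> Au nu; rewrite horner_prod (bigD1 u) ?inE ?nu //=.
  by rewrite !hornerE subrr mul0r.
have St t : S = \sum_(g <- polys_lt j) poly_char (h + g + t *: G).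
  suff permt : perm_eq (polys_lt j) [seq g + t *: G | g <- polys_lt j].
    by rewrite /S (perm_big _ permt) big_map; apply: eq_bigr => g _;
      rewrite addrA.
  apply: uniq_perm; rewrite ?map_inj_uniq ?uniq_polys_lt //; first exact: addIr.
  have sztG : (size (t *: G) <= j)%N.
    by rewrite (leq_trans (size_scale_leq _ _)) ?szG.
  move=> g; rewrite mem_polys_lt; apply/idP/mapP => [sg|[g1]]; last first.
    rewrite mem_polys_lt => sg1 ->.
    by rewrite (leq_trans (size_polyD _ _)) // geq_max sg1.
  exists (g - t *: G); last by rewrite subrK.
  by rewrite mem_polys_lt (leq_trans (size_polyD _ _)) // geq_max size_polyN sg.
have : \sum_(t : F) S = 0.
  rewrite (eq_bigr _ (fun t _ => St t)) exchange_big /= big1 // => g _.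
  rewrite (eq_bigr (fun t => chi ((h + g).[u0] + t * G.[u0]) ^+ a u0 *
     \prod_(u in A | u != u0) chi (h + g).[u] ^+ a u)).
    rewrite -mulr_suml (reindex_onto (fun c => (c - (h + g).[u0]) / G.[u0])
      (fun t => (h + g).[u0] + t * G.[u0])) /=; last first.
      by move=> t _; rewrite addrC addKr mulfK.
    rewrite (eq_bigl predT) => [|c]; last first.
      by rewrite divfK // addrC subrK eqxx.
    rewrite (eq_bigr (fun c => chi c ^+ a u0)) ?chi_sum ?mul0r // => c _.
    by rewrite divfK // addrC subrK.
  move=> t _; rewrite /poly_char (bigD1 u0) //= !hornerE; congr (_ * _).
  by apply: eq_bigr => u /andP[Au nu];
    rewrite hornerD hornerZ Gu // mulr0 addr0.
rewrite sumr_const => /eqP; rewrite mulrn_eq0 => /orP[/eqP F0|/eqP//].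
by have := finNzRing_gt1 F; rewrite [X in (_ < X)%N]F0.
Qed.

Lemma Lcoef_big j : (0 < #|A| <= j)%N -> Lcoef j = 0.
Proof. by move=> ?; rewrite /Lcoef big_map sum_poly_char_coset. Qed.

Lemma Lcoef0 : Lcoef 0 = 1.
Proof.
rewrite /Lcoef /monics /= big_seq1 addr0 expr0.
by rewrite /poly_char big1 // => u _; rewrite hornerC chi1 expr1n.
Qed.

Lemma Lcoef1 : Lcoef 1 = \sum_x \prod_(u in A) chi (x + u) ^+ a u.
Proof.
rewrite /Lcoef big_map big_allpairs_dep big_seq1 big_enum;
  apply: eq_bigr => x _.
apply: eq_bigr => u _; rewrite add0r expr0 expr1 alg_polyC !hornerE.
by rewrite addrC.
Qed.

(** This is L(1) = 0. The character sums to zero over all polynomials of degree below #|A|; it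
    vanishes at 0 and is invariant under nonzero scalars, so this sum is also q - 1 times the sum
    over the monic ones. *)
Lemma sum_Lcoef :
    (0 < #|A|)%N -> (forall t, t != 0 -> \prod_(u in A) chi t ^+ a u = 1) ->
  \sum_(j < #|A|) Lcoef j = 0.
Proof.
move=> A_gt0 chi_prod.
pose U j := \sum_(g <- polys_lt j) poly_char g.
have US j : U j.+1 = U j + (#|F|.-1)%:R * Lcoef j.
  rewrite {1}/U /= big_allpairs_dep exchange_big /= big_enum (bigD1 0) //=.
  congr (_ + _); first by apply: eq_bigr => g _; rewrite scale0r addr0.
  rewrite (eq_bigr (fun _ => Lcoef j)) => [|t t0].
    by rewrite sumr_const (cardC1 0) mulr_natl.
  suff permt : perm_eq (polys_lt j) [seq t *: g | g <- polys_lt j].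
    rewrite /Lcoef big_map (perm_big _ permt) big_map; apply: eq_bigr => g _;
      rewrite addrC -scalerDr.
    rewrite -mul_polyC poly_charM -[RHS]mul1r; congr (_ * _).
    rewrite -(chi_prod _ t0); apply: eq_bigr => u _.
    by rewrite hornerC.
  apply: uniq_perm; rewrite ?map_inj_uniq ?uniq_polys_lt //;
    first exact: scalerI.
  move=> g; rewrite mem_polys_lt; apply/idP/mapP => [sg|[g1]]; last first.
    by rewrite mem_polys_lt => sg1 ->; rewrite size_scale.
  by exists (t^-1 *: g);
    rewrite ?mem_polys_lt ?size_scale ?invr_eq0 // scalerKV.
have Usum j : U j = (#|F|.-1)%:R * \sum_(i < j) Lcoef i.
  elim: j => [|j IHj]; last by rewrite US IHj big_ord_recr mulrDr.
  rewrite big_ord0 mulr0 /U big_seq1 /poly_char.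
  have /card_gt0P[u Au] := A_gt0; rewrite (bigD1 u) //= horner0 chi0 expr0n.
  by rewrite gtn_eqF ?mul0r ?a_gt0.
have := Usum #|A|; rewrite /U -[LHS](eq_bigr _ (fun g _ => congr1 _ (add0r g))).
rewrite sum_poly_char_coset ?A_gt0 ?leqnn // => /esym/eqP.
rewrite mulf_eq0 pnatr_eq0 => /orP[|/eqP//].
by have := finNzRing_gt1 F; case: #|F| => [|[]].
Qed.

End CharacterSums.

End PolynomialsOverFiniteField.

(** * Frobenius orbits *)

Lemma sum_bool_size (T : Type) (s : seq T) (P : pred T) :
  (\sum_(x <- s) P x)%N = size (filter P s).
Proof.
by rewrite size_filter -sum1_count [RHS]big_mkcond; apply: eq_bigr => x _;
  case: (P x).
Qed.

Lemma sum_bool_uniq (T : eqType) (s t : seq T) (P Q : pred T) :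
    uniq s -> uniq t -> (forall x, P x && (x \in s) = Q x && (x \in t)) ->
  (\sum_(x <- s) P x = \sum_(x <- t) Q x)%N.
Proof.
move=> us ut eqPQ; rewrite !sum_bool_size; apply/perm_size/uniq_perm.
- exact: filter_uniq.
- exact: filter_uniq.
by move=> x; rewrite !mem_filter.
Qed.

Lemma sum_count_mem (T : eqType) (s : seq T) :
  (\sum_(x <- undup s) count_mem x s)%N = size s.
Proof.
rewrite -[in RHS](perm_size (perm_count_undup s)) size_flatten /shape -map_comp.
by rewrite sumnE big_map; apply: eq_bigr => x _; rewrite /= size_nseq.
Qed.

Lemma sum_bool_multiples e mu j : (0 < e)%N -> (e * mu <= j)%N ->
  (\sum_(1 <= r < j.+1) ((e %| r) && (r %/ e <= mu))%N)%N = mu.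
Proof.
move=> e_gt0 lej; rewrite -[RHS](size_iota 1) -[iota _ _](filter_predT).
rewrite -sum_bool_size -(big_map (muln e) predT (fun _ => 1%N)) /=.
apply: (@sum_bool_uniq _ _ _ (fun r => (e %| r) && (r %/ e <= mu))%N predT).
- exact: iota_uniq.
- by rewrite map_inj_uniq ?iota_uniq // => x y /eqP;
  rewrite eqn_pmul2l // => /eqP.
move=> r; rewrite mem_index_iota /=; apply/idP/mapP => [|[k]].
  case/andP=> /andP[/dvdnP[k ->]]; rewrite mulnK // => lek /andP[k_gt0 _].
  by exists k; rewrite 1?mulnC // mem_iota; move: k_gt0; rewrite muln_gt0; lia.
rewrite mem_iota => /andP[k_gt0 ltk] ->; rewrite dvdn_mulr // mulKn //.
rewrite muln_gt0 e_gt0 k_gt0 /= !ltnS; apply/andP; split; first by lia.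
by apply: leq_trans lej; rewrite leq_mul2l; lia.
Qed.

Section FrobeniusOrbits.

Variables (K : fieldType) (q : nat).
Hypothesis qK : [pchar K].-nat q.

Definition frob (x : K) : K := x ^+ q.

Fact frob_is_zmod_morphism : zmod_morphism frob.
Proof. by move=> x y; rewrite /frob exprB_pchar. Qed.
Fact frob_is_monoid_morphism : monoid_morphism frob.
Proof. by split=> [|x y]; rewrite /frob ?expr1n ?exprMn. Qed.
HB.instance Definition _ := GRing.isZmodMorphism.Build K K frob
  frob_is_zmod_morphism.
HB.instance Definition _ := GRing.isMonoidMorphism.Build K K frob
  frob_is_monoid_morphism.

Lemma expr_frob_inj r : injective (fun x : K => x ^+ (q ^ r)).
Proof.
elim: r => [x y|r IHr x y]; first by rewrite expn0 !expr1.
by rewrite /= !expnS !exprM => /IHr/(@fmorph_inj _ _ frob).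
Qed.

(** For x in the extension of degree r of a field of q elements, this is the characteristic
    polynomial of x: a power of its minimal polynomial. *)
Definition frob_prod r x : {poly K} := \prod_(i < r) ('X - (x ^+ (q ^ i))%:P).

Lemma frob_prod_monic r x : frob_prod r x \is monic.
Proof. exact: monic_prod_XsubC. Qed.

Lemma size_frob_prod r x : size (frob_prod r x) = r.+1.
Proof. by rewrite /frob_prod -big_enum size_prod_XsubC size_enum_ord. Qed.

Lemma frob_prodD r t x :
  frob_prod (r + t) x = frob_prod r x * frob_prod t (x ^+ (q ^ r)).
Proof.
rewrite /frob_prod big_split_ord; congr (_ * _); apply: eq_bigr => i _.
by rewrite -exprM -expnD.
Qed.

Lemma frob_prodM e k x : x ^+ (q ^ e) = x ->
  frob_prod (e * k) x = frob_prod e x ^+ k.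
Proof.
move=> xe; elim: k => [|k IHk]; first by rewrite muln0 /frob_prod big_ord0.
by rewrite mulnS frob_prodD xe IHk exprS.
Qed.

Lemma frob_prod_stable r x : x ^+ (q ^ r) = x ->
  map_poly frob (frob_prod r x) = frob_prod r x.
Proof.
move=> xr; have -> : map_poly frob (frob_prod r x) = frob_prod r (x ^+ q).
  rewrite rmorph_prod; apply: eq_bigr => i _ /=.
  by rewrite rmorphB /= map_polyX map_polyC /= /frob -!exprM mulnC.
case: r xr => [|r] xr; first by rewrite /frob_prod !big_ord0.
rewrite -[in LHS]addn1 -[in RHS]add1n !frob_prodD mulrC -exprM -expnS xr expn1.
by congr (_ * _); rewrite /frob_prod !big_ord1 !expr1.
Qed.

Section StablePoly.

Variables (G : {poly K}) (s : seq K).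
Hypotheses (G_stable : map_poly frob G = G) (Gs : G = \prod_(z <- s) ('X -
  z%:P)).

Lemma dvd_count_mem x k : (('X - x%:P) ^+ k %| G) = (k <= count_mem x s)%N.
Proof. by rewrite -mup_geq ?Gs ?monic_neq0 ?monic_prod_XsubC // mu_prod_XsubC.
  Qed.

(** Frobenius fixes G, hence carries a root to a root of at least the same multiplicity. *)
Lemma count_mem_frob r x : (count_mem x s <= count_mem (x ^+ (q ^ r)) s)%N.
Proof.
elim: r => [|r IHr]; first by rewrite expn0 expr1.
apply: leq_trans IHr _; rewrite expnSr exprM -dvd_count_mem -G_stable.
have -> : 'X - (x ^+ (q ^ r) ^+ q)%:P = map_poly frob ('X - (x ^+ (q ^ r))%:P).
  by rewrite rmorphB /= map_polyX map_polyC.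
by rewrite -rmorphXn dvdp_map dvd_count_mem.
Qed.

Lemma frob_period x : x \in s -> exists2 e, (0 < e)%N & x ^+ (q ^ e) = x.
Proof.
move=> xs; pose t := [seq x ^+ (q ^ i) | i <- iota 0 (size s).+1].
have ts : {subset t <= s}.
  move=> _ /mapP[i _ ->]; rewrite -has_pred1 has_count.
  by apply: leq_trans (count_mem_frob i x); rewrite -has_count has_pred1.
have: ~~ uniq t.
  by apply/negP => /uniq_leq_size/(_ ts); rewrite size_map size_iota ltnn.
case/(uniqPn 0) => i [j [ltij]]; rewrite size_map size_iota => ltj.
rewrite !(nth_map 0%N) ?size_iota // ?(ltn_trans ltij) // !nth_iota ?(ltn_trans
  ltij) //.
rewrite !add0n => eqij; exists (j - i)%N; first by rewrite subn_gt0.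
by apply: (@expr_frob_inj i); rewrite -exprM -expnD subnK // ltnW.
Qed.

(** Let e be the least period of x under Frobenius. Only the multiples r = e k count, and for them
    [frob_prod] is the k-th power of the orbit polynomial of x, which divides G exactly when k is at
    most the multiplicity of x. *)
Lemma sum_frob_prod_dvd x : x \in s ->
  (\sum_(1 <= r < (size s).+1) ((x ^+ (q ^ r) == x) && (frob_prod r x %|
    G)%R))%N
    = count_mem x s.
Proof.
move=> xs; have [e0 e0_gt0 xe0] := frob_period xs.
have ex_e : exists e, (0 < e)%N && (x ^+ (q ^ e) == x) by exists e0;
  rewrite e0_gt0 xe0 eqxx.
case: (ex_minnP ex_e) => e /andP[e_gt0 /eqP xe] min_e {e0 e0_gt0 xe0 ex_e}.
have xek k : x ^+ (q ^ (e * k)) = x.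
  by elim: k => [|k IHk]; rewrite ?muln0 ?expr1 // mulnS expnD exprM xe.
have perr r : (x ^+ (q ^ r) == x) = (e %| r)%N.
  apply/eqP/dvdnP => [xr|[k ->]]; last by rewrite mulnC xek.
  exists (r %/ e)%N; have [r0|r_gt0] := posnP (r %% e)%N.
    by rewrite {1}(divn_eq r e) r0 addn0.
  have: (e <= r %% e)%N.
    rewrite min_e // r_gt0 /= -{2}xr {2}(divn_eq r e) expnD exprM mulnC xek.
    exact: eqxx.
  by rewrite leqNgt ltn_mod e_gt0.
have uniq_orb : uniq [seq x ^+ (q ^ (i : 'I_e)) | i <- enum 'I_e].
  rewrite map_inj_in_uniq ?enum_uniq // => i j _ _.
  wlog ltij : i j / (i < j)%N.
    by move=> IH; case: (ltngtP i j) => [/IH|/IH+ /esym|/val_inj] //;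
      move=> + eij => /(_ eij).
  move=> eij; have: (e <= j - i)%N.
    rewrite min_e // subn_gt0 ltij /=; apply/eqP/(@expr_frob_inj i).
    by rewrite -exprM -expnD subnK // ltnW.
  by have := ltn_ord j; lia.
have dvdk k : (frob_prod (e * k) x %| G)%R = (k <= count_mem x s)%N.
  rewrite frob_prodM //; apply/idP/idP => [dvdG|lek].
    rewrite -dvd_count_mem (dvdp_trans _ dvdG) // dvdp_exp2r //.
    rewrite /frob_prod -(prednK e_gt0) big_ord_recl expn0 expr1.
    exact: dvdp_mulr.
  rewrite /frob_prod -prodrXl -(big_map (fun i : 'I_e => x ^+ (q ^ i)) predT
    (fun y => ('X - y%:P) ^+ k)).
  have : {subset [seq x ^+ (q ^ (i : 'I_e)) | i <- index_enum 'I_e]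
     <= [pred y | ('X - y%:P) ^+ k %| G]}.
    move=> _ /mapP[i _ ->]; rewrite inE dvd_count_mem.
    exact: leq_trans lek (count_mem_frob _ _).
  move: uniq_orb; rewrite enumT; move: (map _ _) => t.
  elim: t => [|y t IHt] /=; first by rewrite big_nil dvd1p.
  case/andP=> yt ut st; rewrite big_cons Gauss_dvdp.
    have -> /= : ('X - y%:P) ^+ k %| G by apply: (st y); exact: mem_head.
    by apply: IHt => // z zt; apply: st; rewrite inE zt orbT.
  rewrite prodrXl coprimep_expl // coprimep_expr //.
  by rewrite coprimep_sym coprimep_XsubC root_prod_XsubC.
rewrite -[RHS](@sum_bool_multiples e _ (size s)) //.
  apply: eq_bigr => r _; rewrite perr;
    case: (boolP (e %| r)%N) => //= /dvdnP[k ->].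
  by rewrite mulnC dvdk mulKn.
have /dvdp_leq : frob_prod (e * count_mem x s) x %| G by rewrite dvdk.
by rewrite size_frob_prod {2}Gs size_prod_XsubC ltnS; apply;
  rewrite Gs monic_neq0 ?monic_prod_XsubC.
Qed.

(** The analogue of log n = \sum_(m | n) Lambda(m), with the degree as logarithm: add up the
    multiplicities of the distinct roots. An x whose [frob_prod] divides G is itself a root, so
    [E r] may replace s. *)
Lemma sum_frob_prod_dvd_all (E : nat -> seq K) :
    (forall r, (0 < r)%N -> uniq (E r)) ->
    (forall r x, (0 < r)%N -> (x \in E r) = (x ^+ (q ^ r) == x)) ->
  (\sum_(1 <= r < (size s).+1) \sum_(x <- E r) (frob_prod r x %| G)%R)%N = size
    s.
Proof.
move=> uE memE; rewrite -[RHS]sum_count_mem.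
rewrite (eq_big_nat _ _ (F2 := fun r => \sum_(x <- undup s)
   ((x ^+ (q ^ r) == x) && (frob_prod r x %| G)%R))%N); last first.
  move=> r /andP[r_gt0 _]; apply: sum_bool_uniq => [||x];
    [exact: uE|exact: undup_uniq|].
  rewrite mem_undup memE // andbC -andbA; case: eqP => //= _.
  case: (boolP (_ %| G)) => //= dvdG; symmetry.
  rewrite -has_pred1 has_count -dvd_count_mem expr1 (dvdp_trans _ dvdG) //.
  by rewrite /frob_prod -(prednK r_gt0) big_ord_recl expn0 expr1 dvdp_mulr.
rewrite exchange_big /= big_seq [RHS]big_seq; apply: eq_bigr => x.
by rewrite mem_undup => /sum_frob_prod_dvd.
Qed.

End StablePoly.

End FrobeniusOrbits.

(** * The extensions of F inside K, and descent of characteristic polynomials to F *)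

Section FrobeniusDescent.

Variables (F : finFieldType) (K : closedFieldType) (iota : {rmorphism F -> K}).
Let q := #|F|.
Hypothesis qK : [pchar K].-nat q.

Lemma card_field_gt1 : (1 < q)%N. Proof. exact: finNzRing_gt1. Qed.

(** For r > 0, the subfield of K with q ^ r elements. *)
Definition frob_roots (r : nat) : seq K :=
  sval (closed_field_poly_normal ('X^(q ^ r) - 'X : {poly K})).

Lemma frob_rootsE r : (0 < r)%N ->
  'X^(q ^ r) - 'X = \prod_(z <- frob_roots r) ('X - z%:P).
Proof.
move=> r_gt0; have := svalP (closed_field_poly_normal ('X^(q ^ r) - 'X : {poly
  K})).
rewrite -/(frob_roots r) lead_coefDl ?lead_coefXn ?scale1r //.
rewrite size_polyN size_polyXn size_polyX ltnS.
by rewrite (ltn_exp2l 0) // card_field_gt1.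
Qed.

Lemma mem_frob_roots r x : (0 < r)%N -> (x \in frob_roots r) = (x ^+ (q ^ r) ==
  x).
Proof.
move=> r_gt0; rewrite -root_prod_XsubC -frob_rootsE // rootE !hornerE subr_eq0.
by [].
Qed.

(** The derivative of X ^ (q ^ r) - X is the constant -1. *)
Lemma uniq_frob_roots r : (0 < r)%N -> uniq (frob_roots r).
Proof.
move=> r_gt0; rewrite -separable_prod_XsubC -frob_rootsE //.
have q0 : (q ^ r)%:R = 0 :> K.
  have [p pK] : exists p, p \in [pchar K].
    exists (pdiv q); apply: (pnatPpi qK); rewrite pi_pdiv.
    exact: card_field_gt1.
  apply/eqP; rewrite -(dvdn_pcharf pK).
  have : p.-nat q by rewrite -(eq_pnat _ (pcharf_eq pK)).
  case/p_natP=> k Dk.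
  rewrite -/q Dk -expnM dvdn_exp // muln_gt0 r_gt0 andbT lt0n.
  by apply: contraTneq card_field_gt1 => k0; rewrite Dk k0.
rewrite unlock derivB derivXn derivX -mulr_natr -polyC_natr q0 mulr0 sub0r.
by rewrite -[X in coprimep _ X]scaleN1r coprimepZr ?coprimep1 // oppr_eq0
  oner_eq0.
Qed.

Lemma size_frob_roots r : (0 < r)%N -> size (frob_roots r) = (q ^ r)%N.
Proof.
move=> r_gt0; apply: succn_inj; rewrite -(size_prod_XsubC _ id) -frob_rootsE //.
by rewrite size_polyDl ?size_polyXn // size_polyN size_polyX ltnS (ltn_exp2l 0)
  // card_field_gt1.
Qed.

Lemma frob_fixed_iota y : y ^+ q = y -> exists t, iota t = y.
Proof.
move=> yq; have : root (map_poly iota ('X^q - 'X)) y.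
  by rewrite rmorphB /= map_polyXn map_polyX rootE !hornerE yq subrr.
rewrite finField_genPoly rmorph_prod rootE horner_prod prodf_seq_eq0.
case/hasP=> t _; rewrite /= rmorphB /= map_polyX map_polyC !hornerE subr_eq0.
by move=> /eqP ->; exists t.
Qed.

(** When x ^ (q ^ r) = x, the coefficients of [frob_prod q r x] are fixed by Frobenius and come from
    F, so the default 0 is never taken. *)
Definition frob_desc r x : {poly F} :=
  \poly_(i < r.+1) odflt 0 [pick t | iota t == (frob_prod q r x)`_i].

Lemma map_frob_desc r x : x ^+ (q ^ r) = x ->
  map_poly iota (frob_desc r x) = frob_prod q r x.
Proof.
move=> xr; apply/polyP => i; rewrite coef_map coef_poly.
case: ltnP => [_|ler]; last first.
  by rewrite nth_default ?size_frob_prod //; exact: rmorph0.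
have : (frob_prod q r x)`_i ^+ q = (frob_prod q r x)`_i.
  by rewrite -{2}(frob_prod_stable qK xr) coef_map.
case/frob_fixed_iota=> t0 t0E; case: pickP => [t /eqP //|/(_ t0)].
by rewrite t0E eqxx.
Qed.

Lemma frob_desc_monics r x : x ^+ (q ^ r) = x -> frob_desc r x \in monics F r.
Proof.
move=> xr; rewrite mem_monics -(map_monic iota) -(size_map_poly iota).
by rewrite map_frob_desc // frob_prod_monic size_frob_prod eqxx.
Qed.

Lemma iota_frob u i : iota u ^+ (q ^ i) = iota u.
Proof.
elim: i => [|i IHi]; first by rewrite expr1.
by rewrite expnS exprM -rmorphXn expf_card.
Qed.

(** The right-hand side is the norm of u - x to F; u is fixed by Frobenius, so u - x ^ (q ^ i) = (u
    - x) ^ (q ^ i). *)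
Lemma frob_desc_horner r x u : x ^+ (q ^ r) = x ->
  iota (frob_desc r x).[u] = (iota u - x) ^+ (\sum_(i < r) q ^ i).
Proof.
move=> xr; rewrite -horner_map map_frob_desc // horner_prod -prodrXr.
apply: eq_bigr => i _; rewrite !hornerE exprB_pchar ?iota_frob //.
by rewrite pnatX qK.
Qed.

Section LogDerivative.

Variable X : {poly F} -> algC.
Hypothesis XM : {morph X : g h / g * h}.

(** By [frob_desc_horner], for X = [poly_char] this is the character sum over the extension of
    degree r, the character being lifted through the norm. *)
Definition char_sum r : algC := \sum_(x <- frob_roots r) X (frob_desc r x).

(* The coefficient form of T L'(T) = L(T) \sum_r S_r T ^ r. *)
Lemma char_sum_recursion j :
  (\sum_(g <- monics F j) X g) *+ j =
  \sum_(1 <= r < j.+1) char_sum r * \sum_(g <- monics F (j - r)) X g.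
Proof.
(* Replace the degree j of g by the number of pairs (r, x) such that [frob_prod q r x] divides g. *)
transitivity (\sum_(g <- monics F j) \sum_(1 <= r < j.+1)
    \sum_(x <- frob_roots r) X g *+ (frob_prod q r x %| map_poly iota g)%R).
  rewrite -sumrMnl big_seq [RHS]big_seq; apply: eq_bigr => g.
  rewrite mem_monics => /andP[mong /eqP sg].
  have [s Ds] := closed_field_poly_normal (map_poly iota g).
  have lg : lead_coef (map_poly iota g) = 1 by apply/monicP; rewrite map_monic.
  rewrite lg scale1r in Ds.
  have <- : size s = j.
    by apply: succn_inj; rewrite -(size_prod_XsubC _ id) -Ds size_map_poly.
  rewrite -{1}(@sum_frob_prod_dvd_all K q qK (map_poly iota g) s _ Ds
    frob_roots).
  - rewrite -sumrMnr; apply: eq_bigr => r _; rewrite -sumrMnr.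
    by [].
  - rewrite -map_poly_comp; apply: eq_map_poly => t /=.
    by rewrite /frob -[q]muln1 -(expn1 q) muln1 iota_frob.
  - exact: uniq_frob_roots.
  - exact: mem_frob_roots.
rewrite exchange_big /=; apply: eq_big_nat => r /andP[r_gt0 ler].
rewrite exchange_big /= /char_sum mulr_suml big_seq [RHS]big_seq.
apply: eq_bigr => x; rewrite mem_frob_roots // => /eqP xr.
set C := frob_desc r x; have Cr : C \in monics F r by exact: frob_desc_monics.
move: (Cr); rewrite mem_monics => /andP[monC /eqP szC].
have C0 : C != 0 by exact: monic_neq0.
rewrite mulr_sumr -(eq_bigr _ (fun h _ => XM C h)) -(big_map ( *%R C) predT X).
(* For fixed x, the monic g of degree j divisible by C are the C h with h monic of degree j - r. *)
suff permC : perm_eq [seq C * h | h <- monics F (j - r)]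
    [seq g <- monics F j | C %| g].
  rewrite (perm_big _ permC) big_filter [RHS]big_mkcond;
    apply: eq_bigr => g _ /=.
  by rewrite -map_frob_desc // dvdp_map; case: (C %| g).
apply: uniq_perm.
- by rewrite map_inj_uniq ?uniq_monics //; exact: mulfI.
- by rewrite filter_uniq ?uniq_monics.
move=> g; rewrite mem_filter mem_monics; apply/mapP/andP => [[h]|].
  rewrite mem_monics => /andP[monh /eqP szh] ->; split; first exact: dvdp_mulIl.
  rewrite monicMl // monh size_monicM ?monic_neq0 // szC szh /=.
  by apply/eqP; lia.
case=> /dvdpP[h ->] /andP[monh /eqP szh]; exists h; last exact: mulrC.
rewrite mem_monics -(monicMr h monC) monh /=.
have h0 : h != 0 by apply: contraTneq monh => ->;
  rewrite mul0r monicE lead_coef0 eq_sym oner_eq0.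
apply/eqP; move: szh; rewrite mulrC size_monicM // szC addSn /= => szh.
by rewrite -(addKn r (size h)) szh subSn.
Qed.

End LogDerivative.

End FrobeniusDescent.

(** * Power sums *)

Section PowerSums.

Implicit Types (ws : seq algC) (w : algC).

Definition lin_prod ws : {poly algC} := \prod_(w <- ws) (1 - w *: 'X).

Lemma coef_lin_prod_cons w ws j :
  (lin_prod (w :: ws))`_j =
    (lin_prod ws)`_j - w * (if j is i.+1 then (lin_prod ws)`_i else 0).
Proof.
rewrite /lin_prod big_cons mulrBl mul1r -scalerAl coefB coefZ coefXM.
by case: j.
Qed.

(** Newton's identities: the coefficients of T L'(T) = - L(T) \sum_r p_r T ^ r, with p_r the power
    sums. *)
Lemma newton_lin_prod ws j :
  (lin_prod ws)`_j.+1 *+ j.+1 =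
  - \sum_(r < j.+1) (\sum_(w <- ws) w ^+ r.+1) * (lin_prod ws)`_(j - r).
Proof.
elim: ws j => [|w ws IHws] j.
  rewrite /lin_prod big_nil coef1 mul0rn big1 ?oppr0 // => r _.
  by rewrite big_nil mul0r.
set L := lin_prod ws in IHws *; set L' := lin_prod _.
pose U j := \sum_(r < j.+1) (\sum_(w <- ws) w ^+ r.+1) * L`_(j - r).
(* The new factor 1 - w T cancels the geometric series of w. *)
have geom : \sum_(r < j.+1) w ^+ r.+1 * L'`_(j - r) = w * L`_j.
  elim: j => [|j IHj].
    by rewrite big_ord1 subnn coef_lin_prod_cons mulr0 subr0 expr1.
  rewrite big_ord_recl subn0 coef_lin_prod_cons -/L.
  rewrite (eq_bigr (fun r : 'I_j.+1 => w * (w ^+ r.+1 * L'`_(j - r)))) => [|r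
    _].
    by rewrite -mulr_sumr IHj expr1; ring.
  by rewrite lift0 subSS mulrA -exprS.
have conv : \sum_(r < j.+1) (\sum_(v <- ws) v ^+ r.+1) * L'`_(j - r) =
    U j - w * (if j is i.+1 then U i else 0).
  case: j {geom} => [|j].
    by rewrite /U !big_ord1 subnn coef_lin_prod_cons !mulr0 !subr0.
  rewrite /U mulr_sumr [in LHS]big_ord_recr [X in _ = X - _]big_ord_recr /=
    subnn.
  rewrite coef_lin_prod_cons mulr0 subr0 addrAC -sumrB; congr (_ + _).
  apply: eq_bigr => r _; rewrite subSn; last by rewrite -ltnS.
  by rewrite coef_lin_prod_cons -/L; ring.
rewrite (eq_bigr (fun r : 'I_j.+1 => w ^+ r.+1 * L'`_(j - r) +
    (\sum_(v <- ws) v ^+ r.+1) * L'`_(j - r))) => [|r _]; last first.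
  by rewrite big_cons mulrDl.
rewrite big_split /= geom conv coef_lin_prod_cons -/L mulrnBl (IHws j) -/(U j).
case: j {geom conv} => [|j]; first by rewrite mulr1n; ring.
by rewrite mulrS -mulrnAr (IHws j) -/(U j); ring.
Qed.

(** S obeys the recursion of Newton's identities up to sign, and c 0 = 1 allows solving it for each
    term in turn. *)
Lemma power_sums_of_recursion ws (c S : nat -> algC) :
    (forall j, c j = (lin_prod ws)`_j) -> c 0%N = 1 ->
    (forall j, c j *+ j = \sum_(1 <= r < j.+1) S r * c (j - r)%N) ->
  forall r, S r.+1 = - \sum_(w <- ws) w ^+ r.+1.
Proof.
move=> cE c0 cS r; elim/ltn_ind: r => r IHr.
have := cS r.+1; rewrite cE newton_lin_prod big_add1 /= big_mkord.
rewrite !big_ord_recr /= !subnn -cE c0 !mulr1 opprD -sumrN.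
rewrite (eq_bigr (fun i : 'I_r => S i.+1 * c (r.+1 - i.+1)%N)) => [/addrI<-
  //|i _].
by rewrite IHr // cE subSS mulNr.
Qed.

(** The constant term 1 keeps 0 from being a root; the [ws] are the inverses of the roots. *)
Lemma lin_prod_factor (c : nat -> algC) m :
    (0 < m)%N -> c 0%N = 1 -> (forall j, (m <= j)%N -> c j = 0) ->
  exists2 ws, (size ws < m)%N & forall j, c j = (lin_prod ws)`_j.
Proof.
move=> m_gt0 c0 c_big; pose P := \poly_(j < m) c j.
have PE j : P`_j = c j by rewrite coef_poly; case: ltnP => // /c_big.
have [s Ps] := closed_field_poly_normal P.
have P0 : P != 0.
  by apply: contra_eq_neq c0 => P0; rewrite -PE P0 coef0 eq_sym oner_eq0.
have szs : size P = (size s).+1.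
  by rewrite Ps size_scale ?lead_coef_eq0 // size_prod_XsubC.
have s0 : 0 \notin s.
  rewrite -root_prod_XsubC -(rootZ _ _ (_ : lead_coef P != 0)) ?lead_coef_eq0
    // -Ps.
  by rewrite rootE horner_coef0 PE c0 oner_eq0.
exists [seq z^-1 | z <- s]; first by rewrite size_map -szs size_poly.
have [k Pk] : exists k, P = k *: lin_prod [seq z^-1 | z <- s].
  exists (lead_coef P * \prod_(z <- s) (- z)); rewrite -scalerA {1}Ps;
    congr (_ *: _).
  rewrite /lin_prod big_map; elim: s s0 {Ps szs} => [|z s IHs].
    by rewrite !big_nil scale1r.
  rewrite inE negb_or => /andP[z0 /IHs]; rewrite !big_cons => ->.
  have -> : 'X - z%:P = (- z) *: (1 - z^-1 *: 'X).
    by rewrite scalerBr scalerA mulNr mulfV 1?eq_sym // scaleN1r opprK addrC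
      scaleNr alg_polyC.
  by rewrite -scalerAl -scalerAr scalerA.
have Pk0 : P`_0 = k.
  rewrite Pk coefZ -horner_coef0 horner_prod big1 ?mulr1 // => w _.
  by rewrite !hornerE subr0.
by move=> j; rewrite -PE Pk coefZ -Pk0 PE c0 mul1r.
Qed.

Lemma lin_prod_one ws m (c : nat -> algC) :
    (size ws < m)%N -> (forall j, c j = (lin_prod ws)`_j) ->
    \sum_(j < m) c j = 0 -> 1 \in ws.
Proof.
move=> szws cE; rewrite (eq_bigr (fun j : 'I_m => (lin_prod ws)`_j * 1 ^+ j)).
  rewrite -horner_coef_wide.
    rewrite horner_prod => /eqP; rewrite prodf_seq_eq0 => /hasP[w wws /=].
    by rewrite !hornerE subr_eq0 => /eqP ->.
  apply: leq_trans szws; elim: ws {cE} => [|w ws IHws].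
    by rewrite /lin_prod big_nil size_poly1.
  rewrite /lin_prod big_cons; apply: leq_trans (size_polyMleq _ _) _.
  have : (size (1 - w *: 'X : {poly algC})%R <= 2)%N.
    apply: leq_trans (size_polyD _ _) _; rewrite geq_max size_poly1 size_polyN.
    by rewrite (leq_trans (size_scale_leq _ _)) ?size_polyX.
  by move: IHws; rewrite /lin_prod /=; lia.
by move=> j _; rewrite cE expr1n mulr1.
Qed.

Lemma bernoulli_ineq (t : algC) r : 1 <= t -> (t - 1) *+ r <= t ^+ r.
Proof.
move=> t1; suff: 1 + (t - 1) *+ r <= t ^+ r.
  by apply: le_trans; rewrite lerDr.
have t0 : 0 <= t - 1 by rewrite subr_ge0.
elim: r => [|r IHr]; first by rewrite addr0 expr0.
rewrite exprSr; apply: le_trans (ler_wpM2r (le_trans ler01 t1) IHr).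
rewrite -subr_ge0 mulrSr; move: ((t - 1) *+ r) (mulrn_wge0 r t0) => u u0.
have -> : (1 + u) * t - (1 + (u + (t - 1))) = u * (t - 1) by ring.
exact: mulr_ge0.
Qed.

(* A polynomial vanishing at all the w <> w0 isolates the term of w0 in the
   power sums. *)
Lemma power_sum_bound ws (B C0 : algC) r0 :
    0 <= B -> 0 <= C0 ->
    (forall r, (r0 <= r)%N -> `|\sum_(w <- ws) w ^+ r| <= C0 * B ^+ r) ->
  forall w, w \in ws -> `|w| <= B.
Proof.
move=> B0 C00 sumB w0 w0ws.
pose l := \prod_(v <- rem w0 (undup ws)) ('X - v%:P).
have lv v : v \in ws -> v != w0 -> l.[v] = 0.
  move=> vws nv; apply/eqP; rewrite -/(root l v) root_prod_XsubC.
  by rewrite mem_rem_uniq ?undup_uniq // inE nv mem_undup.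
have lw0 : l.[w0] != 0.
  by rewrite -/(root l w0) root_prod_XsubC mem_rem_uniq ?undup_uniq // inE eqxx.
have isolate r : \sum_(k < size l) l`_k * (\sum_(w <- ws) w ^+ (r + k)) =
    (l.[w0] * w0 ^+ r) *+ count_mem w0 ws.
  rewrite (eq_bigr (fun k : 'I_(size l) => \sum_(w <- ws) l`_k * w ^+ k * w ^+
    r)).
    rewrite exchange_big /= (eq_bigr (fun w => l.[w] * w ^+ r)) => [|w _].
      rewrite (bigID (pred1 w0)) /= [X in _ + X]big_seq_cond [X in _ + X]big1.
        rewrite addr0 (eq_bigr (fun _ => l.[w0] * w0 ^+ r)) => [|w /eqP->//].
        by rewrite big_const_seq iter_addr_0.
      by move=> w /andP[wws nw]; rewrite lv // mul0r.
    by rewrite horner_coef mulr_suml.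
  by move=> k _; rewrite mulr_sumr; apply: eq_bigr => w _; rewrite exprD; ring.
pose C1 := \sum_(k < size l) `|l`_k| * (C0 * B ^+ k).
have C10 : 0 <= C1.
  by apply: sumr_ge0 => k _; rewrite !mulr_ge0 // exprn_ge0.
have bound r : (r0 <= r)%N -> `|l.[w0]| * `|w0| ^+ r <= C1 * B ^+ r.
  move=> ler; apply: (@le_trans _ _ `|(l.[w0] * w0 ^+ r) *+ count_mem w0 ws|).
    have : (0 < count_mem w0 ws)%N by rewrite -has_count has_pred1.
    rewrite normrMn normrM normrX; case: (count_mem w0 ws) => // k _.
    by rewrite mulrS lerDl mulrn_wge0 // mulr_ge0 ?exprn_ge0.
  rewrite -isolate mulr_suml; apply: le_trans (ler_norm_sum _ _ _) _.
  apply: ler_sum => k _; rewrite normrM -mulrA ler_wpM2l //.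
  by rewrite -mulrA -exprD addnC sumB // (leq_trans ler) ?leq_addl ?leq_addr.
rewrite real_leNgt ?normr_real ?ger0_real //; apply/negP => ltB.
have w0_gt0 : 0 < `|w0| by apply: le_lt_trans ltB.
have lw0_gt0 : 0 < `|l.[w0]| by rewrite normr_gt0.
have [B_eq0|B_neq0] := eqVneq B 0.
  have := bound r0.+1 (leqnSn _); rewrite B_eq0 expr0n mulr0.
  by rewrite real_leNgt ?mulr_gt0 ?exprn_gt0 ?real0 // gtr0_real ?mulr_gt0
    ?exprn_gt0.
have B_gt0 : 0 < B by rewrite lt_def B_neq0.
(* The powers of t are bounded, while t > 1 makes them grow at least linearly by Bernoulli's
   inequality. *)
pose t := `|w0| / B.
have t_gt1 : 1 < t by rewrite ltr_pdivlMr ?mul1r.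
have t1_gt0 : 0 < t - 1 by rewrite subr_gt0.
have boundt r : (r0 <= r)%N -> t ^+ r <= C1 / `|l.[w0]|.
  move=> /bound ler; rewrite ler_pdivlMr // mulrC /t exprMn exprVn mulrA.
  by rewrite ler_pdivrMr ?exprn_gt0.
pose b := C1 / `|l.[w0]| / (t - 1).
have b_ge0 : 0 <= b by rewrite !divr_ge0 // ltW.
have := archi_boundP b_ge0; set n := Num.bound b => ltbn.
have := le_trans (bernoulli_ineq (n + r0) (ltW t_gt1)) (boundt _ (leq_addl _
  _)).
rewrite -mulr_natr mulrC -ler_pdivlMr // -/b natrD.
rewrite real_leNgt ?ger0_real ?addr_ge0 //.
by rewrite (lt_le_trans ltbn) // lerDl.
Qed.

End PowerSums.

(** * The Weil bound *)

Lemma prim_root_neq0 (R : nzRingType) n (z : R) : n.-primitive_root z -> z != 0.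
Proof.
move=> prz; apply: contra_eq_neq (prim_expr_order prz) => ->.
by rewrite expr0n gtn_eqF ?(prim_order_gt0 prz) // eq_sym oner_eq0.
Qed.

Lemma prim_root_sum0 (R : idomainType) n (z : R) : (1 < n)%N ->
  n.-primitive_root z -> \sum_(k < n) z ^+ k = 0.
Proof.
move=> n_gt1 prz; apply/eqP; have := subrX1 z n;
  rewrite prim_expr_order // subrr.
move/esym/eqP; rewrite mulf_eq0 => /orP[|//].
by rewrite subr_eq0 -(expr1 z) -(prim_order_dvd prz) dvdn1 gtn_eqF.
Qed.

(* Upper bounds on the fibres force equidistribution, since the fibres have a
   prescribed total size. *)
Lemma equidistributed_sum (I : eqType) (s : seq I) (v : I -> algC) (eta : algC)
    (d B l : nat) :
    d.-primitive_root eta -> (1 < d)%N ->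
    (forall k, (d * count (fun x => v x == eta ^+ k) s <= B)%N) ->
    (forall x, x \in s -> v x != 0 -> exists k, v x = eta ^+ k) ->
    (count (fun x => v x == 0%R) s <= l)%N ->
  `|\sum_(x <- s) v x| <= (B + l)%:R - (size s)%:R.
Proof.
move=> pr_eta d_gt1 fibre_le v_eta count0.
pose n k := count (fun x => v x == eta ^+ k) s.
have d_gt0 : (0 < d)%N by exact: ltnW.
have eta0 : eta != 0 by exact: prim_root_neq0 pr_eta.
have fibreE x : x \in s -> v x != 0 ->
    exists k : 'I_d, v x = eta ^+ k /\ forall i : 'I_d, (v x == eta ^+ i) = (i
      == k).
  move=> xs vx0; have [k vk] := v_eta x xs vx0.
  rewrite -(prim_expr_mod pr_eta) in vk.
  exists (Ordinal (ltn_pmod k d_gt0)); split=> // i.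
  rewrite vk (eq_prim_root_expr pr_eta) modn_mod (modn_small (ltn_ord i)).
  by rewrite eq_sym.
have nE k : n k = (\sum_(x <- s) (v x == eta ^+ k))%N.
  by rewrite sum_bool_size size_filter.
have sum_v : \sum_(x <- s) v x = \sum_(k < d) eta ^+ k * (n k)%:R.
  rewrite [RHS](eq_bigr (fun k : 'I_d => \sum_(x <- s) eta ^+ k *+ (v x == eta
    ^+ k)));
    last by move=> k _; rewrite nE sumrMnr mulr_natr.
  rewrite [RHS]exchange_big [LHS]big_seq [RHS]big_seq /=;
    apply: eq_bigr => x xs.
  have [v0|/(fibreE x xs)[k [vk vE]]] := eqVneq (v x) 0.
    by rewrite v0 big1 // => k _; rewrite eq_sym expf_eq0 (negPf eta0) andbF.
  rewrite (bigD1 k) //= vE eqxx -vk big1 ?addr0 // => i ni.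
  by rewrite vE (negPf ni).
have size_s : (\sum_(k < d) n k + count (fun x => v x == 0%R) s = size s)%N.
  rewrite -(count_predC (fun x => v x == 0) s) addnC; congr (_ + _)%N.
  rewrite (eq_bigr (fun k : 'I_d => \sum_(x <- s) (v x == eta ^+ k))%N (fun k _
    => nE k)) [LHS]exchange_big -size_filter -sum_bool_size.
  rewrite [LHS]big_seq [RHS]big_seq /=; apply: eq_bigr => x xs.
  have [v0|/(fibreE x xs)[k [vk vE]]] := eqVneq (v x) 0.
    by rewrite v0 big1 // => k _; rewrite eq_sym expf_eq0 (negPf eta0) andbF.
  rewrite (bigD1 k) //= vE eqxx big1 ?addn0 // => i ni.
  by rewrite vE (negPf ni).
have d_posR : 0 < d%:R :> algC by rewrite ltr0n.
rewrite -(ler_pM2l d_posR) -{1}[d%:R](normr_nat algC) -normrM sum_v mulr_sumr.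
(* The powers of eta add up to 0, so shifting all coefficients by B is free; it makes B - d n_k
   nonnegative, and the triangle inequality then loses nothing but the zeros of v. *)
have -> : \sum_(k < d) d%:R * (eta ^+ k * (n k)%:R) =
    - \sum_(k < d) eta ^+ k * (B - d * n k)%:R.
  apply/eqP; rewrite -subr_eq0 opprK -big_split /=.
  rewrite (eq_bigr (fun k : 'I_d => B%:R * eta ^+ k)) => [|k _].
    by rewrite -mulr_sumr prim_root_sum0 // mulr0.
  by rewrite (natrB _ (fibre_le k)) (natrM _ d (n k)); ring.
rewrite normrN; apply: le_trans (ler_norm_sum _ _ _) _.
have norm_eta k : `|eta ^+ k| = 1.
  rewrite normrX (_ : `|eta| = 1) ?expr1n //.
  apply/eqP; rewrite -(@pexpr_eq1 _ _ d) // -normrX (prim_expr_order pr_eta).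
  by rewrite normr1.
rewrite (eq_bigr (fun k : 'I_d => B%:R - d%:R * (n k)%:R)) => [|k _];
  last first.
  by rewrite normrM norm_eta mul1r normr_nat (natrB _ (fibre_le k)) natrM.
rewrite sumrB sumr_const card_ord -[B%:R *+ d]mulr_natl -mulr_sumr -mulrBr
  ler_pM2l //.
rewrite -natr_sum -size_s !natrD opprD addrACA lerDl subr_ge0 ler_nat.
exact: count0.
Qed.

Section CharacterSumBound.

Variables (F : finFieldType) (p k0 : nat).
Let q := #|F|.
Hypotheses (pcharFp : p \in [pchar F]) (qE : q = (p ^ k0)%N).
Variables (theta : F) (d : nat) (zeta : algC) (chi : F -> algC).
Hypotheses (d_dvd : (d %| q.-1)%N) (pr_zeta : d.-primitive_root zeta).
Hypothesis theta_gen : forall x : F, x != 0 -> exists i, x = theta ^+ i.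
Hypotheses (chi0 : chi 0 = 0) (chi_theta : forall i, chi (theta ^+ i) = zeta ^+
  i).

Lemma char1 : chi 1 = 1. Proof. by rewrite -(expr0 theta) chi_theta. Qed.

Lemma charM : {morph chi : x y / x * y}.
Proof.
move=> x y; have [->|/theta_gen[i ->]] := eqVneq x 0;
  first by rewrite mul0r chi0 mul0r.
have [->|/theta_gen[j ->]] := eqVneq y 0; first by rewrite mulr0 chi0 mulr0.
by rewrite -exprD !chi_theta exprD.
Qed.

Lemma generator_neq0 : theta != 0.
Proof.
have zeta0 := prim_root_neq0 pr_zeta.
by apply: contraNneq zeta0 => t0; have := chi_theta 1;
  rewrite !expr1 t0 chi0 => <-.
Qed.

(** Multiplying c by theta multiplies the sum by zeta ^ s, which is not 1. *)
Lemma sum_char_expr s : (0 < s < d)%N -> \sum_c chi c ^+ s = 0.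
Proof.
move=> /andP[s_gt0 s_lt]; set S := \sum_c _.
have : S = zeta ^+ s * S.
  rewrite {1}/S (reindex_onto ( *%R theta) ( *%R theta^-1)) /=; last first.
    by move=> c _; rewrite mulVKf // generator_neq0.
  rewrite mulr_sumr; apply: eq_big => [c|c _];
    first by rewrite mulKf ?generator_neq0 ?eqxx.
  by rewrite charM -{1}(expr1 theta) chi_theta expr1 exprMn.
move/eqP; rewrite -{1}[S]mul1r -subr_eq0 -mulrBl mulf_eq0 => /orP[|/eqP//].
rewrite subr_eq0 eq_sym -(prim_order_dvd pr_zeta) => /(dvdn_leq s_gt0).
by rewrite leqNgt s_lt.
Qed.

Variables (A : {set F}) (a : F -> nat).
Hypotheses (A_gt0 : (0 < #|A|)%N) (a_lt : forall u, u \in A -> (0 < a u < d)%N).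

Let X := poly_char chi A a.
Let e := gcdn d (\big[gcdn/0%N]_(u in A) a u).
Let d' := (d %/ e)%N.
Let b u := (a u %/ e)%N.

Lemma gcd_dvd_order : (e %| d)%N. Proof. exact: dvdn_gcdl. Qed.

Lemma gcd_dvd_exponent u : u \in A -> (e %| a u)%N.
Proof.
move=> Au; apply: dvdn_trans (dvdn_gcdr d _) _.
exact: (@biggcdn_inf _ u (fun v => v \in A) a (a u) Au (dvdnn _)).
Qed.

Lemma order_gt0 : (0 < d)%N. Proof. exact: prim_order_gt0 pr_zeta. Qed.

Lemma gcd_exponents_gt0 : (0 < e)%N. Proof. by rewrite gcdn_gt0 order_gt0. Qed.

Lemma reduced_orderE : (d' * e = d)%N. Proof. exact: divnK gcd_dvd_order. Qed.

Lemma reduced_exponentE u : u \in A -> (b u * e = a u)%N.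
Proof. by move=> /gcd_dvd_exponent; exact: divnK. Qed.

Lemma reduced_order_gt1 : (1 < d')%N.
Proof.
have /card_gt0P[u Au] := A_gt0; have /andP[a_gt0 a_ltd] := a_lt Au.
have := dvdn_leq a_gt0 (gcd_dvd_exponent Au); have := reduced_orderE.
by case: d' => [|[|]] //; [have := order_gt0|]; lia.
Qed.

Lemma reduced_exponents_coprime s : (forall u, u \in A -> (d' %| s * b u)%N) ->
  (d' %| s)%N.
Proof.
move=> d's; rewrite -(dvdn_pmul2r gcd_exponents_gt0) reduced_orderE muln_gcdr
  dvdn_gcd dvdn_mull //=.
apply: (big_ind (fun m => (d %| s * m)%N)) => [|x y|u Au];
  first by rewrite muln0.
  by rewrite muln_gcdr dvdn_gcd => -> ->.
by rewrite -(reduced_exponentE Au) mulnA -reduced_orderE dvdn_pmul2r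
  ?gcd_exponents_gt0 ?d's.
Qed.

Variables (K : closedFieldType) (iota : {rmorphism F -> K}).
Let f : {poly K} := \prod_(u in A) ('X - (iota u)%:P) ^+ b u.

Lemma card_pchar_nat : [pchar K].-nat q.
Proof.
have pK : p \in [pchar K] by rewrite (fmorph_pchar iota).
rewrite qE pnatX (eq_pnat _ (pcharf_eq pK)) pnat_id ?orTb //.
exact: pcharf_prime pcharFp.
Qed.

Lemma branch_poly_neq0 : f != 0.
Proof. by apply/prodf_neq0 => u _; rewrite expf_neq0 ?polyXsubC_eq0. Qed.

Lemma branch_poly_mup s : (forall x, (d' %| s * mup x f)%N) -> (d' %| s)%N.
Proof.
move=> d's; apply: reduced_exponents_coprime => u Au; have := d's (iota u).
rewrite /f (bigD1 u) //= mupMl ?mup_XsubCX ?eqxx //.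
rewrite rootE horner_prod; apply/prodf_neq0 => v /andP[_ nv].
by rewrite horner_exp expf_neq0 // !hornerE subr_eq0 (inj_eq (fmorph_inj iota))
  eq_sym.
Qed.

Lemma branch_poly_frob r : f ^+ (q ^ r) = f \Po 'X^(q ^ r).
Proof.
rewrite /f rmorph_prod -prodrXl; apply: eq_bigr => u _ /=.
rewrite rmorphXn /= -!exprM mulnC exprM; congr (_ ^+ _).
have qPK : [pchar {poly K}].-nat (q ^ r)%N.
  by rewrite pnatX (eq_pnat _ (pchar_poly K)) card_pchar_nat.
by rewrite exprB_pchar // -polyC_exp iota_frob rmorphB /= comp_polyX comp_polyC.
Qed.

Let eta := zeta ^+ e.

Lemma prim_reduced_root : d'.-primitive_root eta.
Proof. by have := exp_prim_root pr_zeta e;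
  rewrite (gcdn_idPl gcd_dvd_order). Qed.

Lemma charX n : {morph chi : x / x ^+ n}.
Proof. by move=> x; elim: n => [|n IHn];
  rewrite ?char1 // !exprS charM IHn. Qed.

Lemma char_eq0 x : (chi x == 0) = (x == 0).
Proof.
have [->|/theta_gen[i ->]] := eqVneq x 0; first by rewrite chi0 eqxx.
by rewrite chi_theta expf_eq0 (negPf (prim_root_neq0 pr_zeta)) andbF.
Qed.

Let base (g : {poly F}) : F := \prod_(u in A) g.[u] ^+ b u.

Lemma poly_char_base g : X g = chi (base g) ^+ e.
Proof.
rewrite /base (big_morph chi charM char1) -prodrXl; apply: eq_bigr => u Au.
by rewrite charX -exprM reduced_exponentE.
Qed.

Let w := (q.-1 %/ d')%N.
(** This is (q ^ r - 1) / d', so x |-> x ^ (N r) is the power residue symbol of order d' on the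
    extension of degree r. *)
Let N r := (w * \sum_(i < r) q ^ i)%N.

Lemma reduced_cofactorE : (d' * w)%N = q.-1.
Proof.
rewrite mulnC divnK //; apply: dvdn_trans d_dvd.
by rewrite -reduced_orderE dvdn_mulr.
Qed.

Lemma stepanov_exponentE r : (d' * N r).+1 = (q ^ r)%N.
Proof.
by rewrite mulnA reduced_cofactorE -predn_exp prednK // expn_gt0 ltnW //
  card_field_gt1.
Qed.

Lemma generator_cofactorX : (theta ^+ w) ^+ d' = 1.
Proof.
rewrite -exprM mulnC reduced_cofactorE; apply: (mulfI generator_neq0).
by rewrite -exprS prednK ?expf_card ?mulr1 // ltnW // card_field_gt1.
Qed.

Let C := (4 * d' * (d' * (size f).-1 + 3))%N.
Let C1 := (C + (size f).-1 + 1)%N.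

(** On a fibre of the character, f(x) ^ (N r) takes a single value c, so Stepanov's bound applies
    with Q = q ^ (2 t) and m = q ^ t. *)
Lemma frob_fibre_le t k : (0 < t)%N -> (C <= q ^ t)%N ->
  (d' * count (fun x => X (frob_desc iota (t + t) x) == eta ^+ k)
     (frob_roots F K (t + t)) <= q ^ (t + t) + C1 * q ^ t)%N.
Proof.
move=> t_gt0 leC; set r := (t + t)%N;
  have r_gt0 : (0 < r)%N by rewrite addn_gt0 t_gt0.
rewrite -size_filter.
(* The sign appears because norms involve u - x while f is a product of powers of x - u. *)
pose c := (-1) ^+ ((\sum_(u in A) b u) * N r)%N * iota (theta ^+ w) ^+ k.
have QE : (q ^ r)%N = (q ^ t * q ^ t)%N by rewrite expnD.
rewrite QE; apply: (@stepanov_bound K p _ f (k0 * r) d' (N r) (q ^ t) _ _ _ _ _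
  _ leC c).
- by rewrite (fmorph_pchar iota).
- by rewrite -QE qE expnM.
- exact: branch_poly_neq0.
- exact: ltnW reduced_order_gt1.
- by rewrite -QE stepanov_exponentE.
- by rewrite -QE branch_poly_frob.
- exact: branch_poly_mup.
- by rewrite mulf_neq0 ?expf_neq0 ?oppr_eq0 ?oner_eq0 // fmorph_eq0 expf_neq0
  ?generator_neq0.
- by rewrite filter_uniq // uniq_frob_roots // card_pchar_nat.
move=> x; rewrite mem_filter mem_frob_roots // => /andP[Xx /eqP xQ].
split; first by rewrite -QE.
set y := base (frob_desc iota r x).
have iy : iota y = ((-1) ^+ (\sum_(u in A) b u) * f.[x]) ^+ (\sum_(i < r) q ^
  i).
  rewrite rmorph_prod /f horner_prod -prodrXr -big_split -prodrXl /=.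
  apply: eq_bigr => u _;
    rewrite rmorphXn /= (frob_desc_horner iota card_pchar_nat u xQ).
  rewrite !hornerE -exprMn mulN1r opprB -!exprM mulnC.
  by [].
have y_neq0 : y != 0.
  apply: contraTneq Xx => y0;
    rewrite poly_char_base -/y y0 chi0 expr0n gtn_eqF ?gcd_exponents_gt0 //=.
  by rewrite eq_sym expf_eq0 (negPf (prim_root_neq0 prim_reduced_root)) andbF.
have [i yi] := theta_gen y_neq0.
(* The root eta has order d' and (theta ^ w) ^ d' = 1, so the exponent of theta matters only modulo
   d'. *)
have ik : i = k %[mod d'].
  by apply/eqP; rewrite -(eq_prim_root_expr prim_reduced_root) -(eqP Xx)
    poly_char_base -/y yi chi_theta -exprM mulnC exprM.
have : (iota y) ^+ w = iota (theta ^+ w) ^+ k.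
  rewrite yi -rmorphXn -exprM mulnC exprM -(expr_mod i generator_cofactorX) ik
    expr_mod ?generator_cofactorX //.
  by rewrite rmorphXn.
rewrite iy -exprM mulnC -/(N r) exprMn -exprM /c => <-.
by rewrite mulrA -exprD addnn -mul2n exprM sqrrN !expr1n mul1r.
Qed.

Lemma frob_char_sum_le t : (0 < t)%N -> (C <= q ^ t)%N ->
  `|char_sum iota X (t + t)| <= (C1 * q ^ t + #|A|)%:R.
Proof.
move=> t_gt0 leC; have r_gt0 : (0 < t + t)%N by rewrite addn_gt0 t_gt0.
apply: le_trans (equidistributed_sum (l := #|A|) prim_reduced_root
  reduced_order_gt1
   (fun k => frob_fibre_le k t_gt0 leC) _ _) _.
- move=> x _; rewrite poly_char_base expf_eq0 gcd_exponents_gt0 /= char_eq0 =>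
  /theta_gen[i ->].
  by exists i; rewrite chi_theta -exprM mulnC exprM.
- rewrite cardE -(size_map iota) -size_filter; apply: uniq_leq_size.
    by rewrite filter_uniq // uniq_frob_roots // card_pchar_nat.
  move=> x; rewrite mem_filter mem_frob_roots // => /andP[Xx /eqP xQ].
  move: Xx; rewrite /X /poly_char prodf_seq_eq0 => /hasP[u _ /andP[Au]].
  rewrite expf_eq0 char_eq0 => /andP[_ /eqP u0]; apply/mapP; exists u;
    first by rewrite mem_enum.
  have := frob_desc_horner iota card_pchar_nat u xQ;
    rewrite u0 rmorph0 => /esym/eqP.
  by rewrite expf_eq0 subr_eq0 => /andP[_ /eqP ->].
by rewrite size_frob_roots ?card_pchar_nat // -addnA natrD addrAC subrr add0r.
Qed.

Let L := Lcoef chi A a.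
Let delta : nat := (d %| \sum_(u in A) a u)%N.

(* When [delta] is 1, L(1) = 0, hence one of the inverse roots of L is 1. *)
Lemma weil_bound : (delta < #|A|)%N /\
  `|L 1 + delta%:R| <= (#|A| - 1 - delta)%:R * sqrtC q%:R.
Proof.
have a_gt0 u : u \in A -> (0 < a u)%N by case/a_lt/andP.
have chi_sum_a u : u \in A -> \sum_c chi c ^+ a u = 0 by move=> /a_lt;
  exact: sum_char_expr.
have L0 : L 0%N = 1 by exact: Lcoef0 char1.
have Lbig j : (#|A| <= j)%N -> L j = 0.
  by move=> leAj; apply: (Lcoef_big chi_sum_a); rewrite A_gt0.
have XM : {morph X : g h / g * h} by move=> g h; exact: poly_charM charM g h.
have Lrec j : L j *+ j = \sum_(1 <= r < j.+1) char_sum iota X r * L (j - r)%N.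
  by have := char_sum_recursion iota card_pchar_nat XM j.
have [ws szws Lws] := lin_prod_factor A_gt0 L0 Lbig.
have S_ws := power_sums_of_recursion Lws L0 Lrec.
have L1 : L 1 = - \sum_(v <- ws) v.
  have := Lrec 1%N; rewrite mulr1n big_nat1 subnn L0 mulr1 => ->.
  by rewrite S_ws; congr (- _); apply: eq_bigr => v _; rewrite expr1.
have ws_le v : v \in ws -> `|v| <= sqrtC q%:R.
  move=> vws; have q_ge0 : 0 <= q%:R :> algC by exact: ler0n.
  rewrite -(@ler_pXn2r _ 2) ?nnegrE ?sqrtC_ge0 // sqrtCK -normrX.
  (* Stepanov's bound is only available for fields whose order is a square. *)
  apply: (@power_sum_bound [seq z ^+ 2 | z <- ws] _ (C1 + #|A|)%:R C.+1) => //.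
    move=> t ltCt; rewrite big_map (eq_bigr (fun z => z ^+ (t + t))) => [|z _];
      last first.
      by rewrite -exprM mul2n addnn.
    have t_gt0 : (0 < t)%N by apply: leq_trans ltCt.
    have := frob_char_sum_le t_gt0;
      rewrite addnn -(prednK t_gt0) doubleS S_ws normrN.
    rewrite -doubleS prednK // => /(_ _)/le_trans; apply.
      by apply: leq_trans (ltnW ltCt) (ltnW (ltn_expl _ (card_field_gt1 F))).
    rewrite -natrX -natrM ler_nat mulnDl leq_add2l leq_pmulr // expn_gt0.
    by rewrite ltnW // card_field_gt1.
  exact: map_f.
have sum_le (s : seq algC) : {subset s <= ws} ->
    `|\sum_(v <- s) v| <= (size s)%:R * sqrtC q%:R.
  move=> sws; apply: le_trans (ler_norm_sum _ _ _) _.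
  have -> : (size s)%:R * sqrtC q%:R = \sum_(v <- s) sqrtC q%:R :> algC.
    by rewrite big_const_seq iter_addr_0 count_predT mulr_natl.
  by rewrite big_seq [X in _ <= X]big_seq; apply: ler_sum => v /sws/ws_le.
have sq_ge0 : 0 <= sqrtC q%:R :> algC by rewrite sqrtC_ge0 ler0n.
have szws1 : (size ws <= #|A| - 1)%N by rewrite -ltnS subn1 prednK.
rewrite /delta; case: (boolP (d %| _)%N) => [dvd_sum|_] /=.
  have ws1 : 1 \in ws.
    apply: (lin_prod_one szws Lws);
      apply: (sum_Lcoef chi0 charM a_gt0 chi_sum_a A_gt0) => t t0.
    rewrite prodrXr; have [i ->] := theta_gen t0;
      rewrite chi_theta -exprM mulnC exprM.
    case/dvdnP: dvd_sum => m ->.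
    by rewrite mulnC exprM (prim_expr_order pr_zeta) !expr1n.
  have szrem : size (rem 1 ws) = (size ws).-1 by rewrite size_rem.
  have ws_gt0 : (0 < size ws)%N by case: (ws) ws1.
  split; first exact: leq_ltn_trans ws_gt0 szws.
  rewrite L1 (perm_big _ (perm_to_rem ws1)) big_cons opprD addrAC addNr add0r
    normrN.
  apply: le_trans (sum_le _ _) _; first exact: mem_rem.
  by rewrite ler_wpM2r // ler_nat szrem -subn1 leq_sub2r.
split=> //; rewrite addr0 L1 normrN; apply: le_trans (sum_le _ _) _ => //.
by rewrite ler_wpM2r // ler_nat subn0.
Qed.

End CharacterSumBound.

(** * Counting solutions *)

Section CountingSolutions.

Variables (F : finFieldType) (p k0 n d : nat).
Let q := #|F|.
Hypotheses (pcharFp : p \in [pchar F]) (qE : q = (p ^ k0)%N) (dnE : (d * n)%N =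
  q.-1).
Variables (theta : F) (zeta : algC) (chi : F -> algC).
Hypotheses (pr_theta : q.-1.-primitive_root theta) (pr_zeta : d.-primitive_root
  zeta).
Hypotheses (chi0 : chi 0 = 0) (chi_theta : forall i, chi (theta ^+ i) = zeta ^+
  i).

Lemma prim_root_gen (x : F) : x != 0 -> exists i, x = theta ^+ i.
Proof.
move=> x0; have q_gt0 : (0 < q)%N by rewrite ltnW // card_field_gt1.
have /(prim_rootP pr_theta)[i ->] : x ^+ q.-1 = 1; last by exists i.
by apply: (mulfI x0); rewrite -exprS prednK // expf_card mulr1.
Qed.

Lemma char_eq1 x : x != 0 -> (chi x == 1) = (x ^+ n == 1).
Proof.
move=> /prim_root_gen[i ->]; rewrite chi_theta -exprM.
have n_gt0 : (0 < n)%N.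
  have := prim_order_gt0 pr_theta; rewrite -dnE muln_gt0; by case/andP.
by rewrite -(prim_order_dvd pr_zeta) -(prim_order_dvd pr_theta) -dnE
  dvdn_pmul2r.
Qed.

Lemma sum_zeta_expr i : \sum_(j < d) (zeta ^+ i) ^+ j = (d * (d %| i))%:R.
Proof.
have [di|ndi] := boolP (d %| i)%N.
  rewrite (eq_bigr (fun _ => 1)) => [|j _];
    first by rewrite sumr_const card_ord muln1.
  by case/dvdnP: di => m ->;
    rewrite mulnC exprM (prim_expr_order pr_zeta) !expr1n.
have := subrX1 (zeta ^+ i) d;
  rewrite -exprM mulnC exprM (prim_expr_order pr_zeta).
rewrite expr1n subrr => /esym/eqP; rewrite mulf_eq0 subr_eq0.
by rewrite -(prim_order_dvd pr_zeta) (negPf ndi) muln0 => /eqP.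
Qed.

(* The number of y in F with y ^ d = x. *)
Definition chi_weight (x : F) : nat :=
  if x == 0 then 1%N else if chi x == 1 then d else 0%N.

Lemma chi_weightE x : (chi_weight x)%:R = \sum_(j < d) chi x ^+ j.
Proof.
have d_gt0 := prim_order_gt0 pr_zeta.
rewrite /chi_weight; have [->|/prim_root_gen[i ->]] := eqVneq x 0.
  rewrite chi0 -(prednK d_gt0) big_ord_recl expr0 big1 ?addr0 // => j _.
  by rewrite expr0n.
rewrite chi_theta -(prim_order_dvd pr_zeta) sum_zeta_expr.
by case: (d %| i)%N; rewrite ?muln1 ?muln0.
Qed.

Let pt (i : 'I_p) : F := (i : nat)%:R.

Lemma natr_ord_inj : injective pt.
Proof.
move=> i j; wlog leij : i j / (i <= j)%N.
  by move=> IH; case/orP: (leq_total i j) => [/IH//|/IH + /esym] => /[apply].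
move=> eij; apply: val_inj => /=; apply/eqP; rewrite eqn_leq leij /= leqNgt.
apply/negP => ltij; have : ((j - i)%N%:R : F) == 0.
  by rewrite natrB // subr_eq0 -[X in X == _]/(pt j) -eij.
rewrite -(dvdn_pcharf pcharFp) => /dvdn_leq; rewrite subn_gt0 => /(_ ltij).
by have := ltn_ord j; lia.
Qed.

Let fam := {ffun 'I_p -> 'I_d}.
Let supp_size (a : fam) : nat := (\sum_(i < p) (a i != 0 :> nat))%N.
Let delta (a : fam) : nat := (d %| \sum_(i < p) a i)%N.
Let trivial (a : fam) : bool := [forall i, a i == 0 :> nat].
Let S (a : fam) : algC := \sum_x \prod_(i < p) chi (x + pt i) ^+ a i.

(** The number of points over F of the curve y_i ^ d = x + i, 0 <= i < p. *)
Definition solution_weight : nat := (\sum_x \prod_(i < p) chi_weight (x + pt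
  i)%R)%N.
Let W := solution_weight.

Lemma solution_weightE : W%:R = \sum_a S a.
Proof.
rewrite natr_sum exchange_big; apply: eq_bigr => x _ /=.
rewrite natr_prod (eq_bigr _ (fun i _ => chi_weightE (x + pt i))).
exact: bigA_distr_bigA.
Qed.

Lemma twisted_sum_trivial a : trivial a -> S a = q%:R.
Proof.
move/forallP=> a0; rewrite /S (eq_bigr (fun _ => 1)) => [|x _];
  first by rewrite sumr_const.
by rewrite big1 // => i _; rewrite (eqP (a0 i)).
Qed.

Lemma supp_size_gt0 a : ~~ trivial a -> (0 < supp_size a)%N.
Proof.
rewrite negb_forall => /existsP[i ai]; rewrite /supp_size (bigD1 i) //= ai.
by [].
Qed.

Lemma twisted_sum_bound a : ~~ trivial a -> (delta a < supp_size a)%N /\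
  `|S a + (delta a)%:R| <= (supp_size a - 1 - delta a)%:R * sqrtC q%:R.
Proof.
move=> nza.
pose A : {set F} := [set pt i | i in [pred i : 'I_p | a i != 0 :> nat]].
(* Since [pt] is injective, this sum has at most one term and transports the exponents from indices
   to points of F. *)
pose aF (u : F) : nat := (\sum_(i < p | pt i == u) a i)%N.
have aFE i : aF (pt i) = a i.
  rewrite /aF (eq_bigl (pred1 i)) ?big_pred1_eq // => j.
  by rewrite (inj_eq natr_ord_inj).
have ptA : {in [pred i : 'I_p | a i != 0 :> nat] &, injective pt} by move=> ? ?
  _ _ /natr_ord_inj.
have cardA : #|A| = supp_size a.
  rewrite card_imset; last exact: natr_ord_inj.
  by rewrite -sum1_card /supp_size big_mkcond; apply: eq_bigr => i _;
    rewrite inE; case: eqP.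
have sumA : (\sum_(u in A) aF u = \sum_(i < p) a i)%N.
  rewrite big_imset //= big_mkcond; apply: eq_bigr => i _; rewrite inE aFE.
  by case: eqP => [->|].
have SE : Lcoef chi A aF 1 = S a.
  rewrite Lcoef1; apply: eq_bigr => x _; rewrite big_imset //= big_mkcond.
  apply: eq_bigr => i _; rewrite inE aFE.
  by case: eqP => [->|]; rewrite ?expr0.
have [K [iota _]] := countable_algebraic_closure F.
have d_dvd : (d %| q.-1)%N by rewrite -dnE dvdn_mulr.
have A_gt0 : (0 < #|A|)%N by rewrite cardA supp_size_gt0.
have aF_lt u : u \in A -> (0 < aF u < d)%N.
  by case/imsetP=> i; rewrite inE => ai ->; rewrite aFE lt0n ai ltn_ord.
have := weil_bound pcharFp qE d_dvd pr_zeta prim_root_gen chi0 chi_theta A_gt0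
  aF_lt iota.
by rewrite SE cardA sumA.
Qed.

Let G : nat := (\sum_(a | ~~ trivial a) (supp_size a - 1 - delta a))%N.

Lemma trivial_unique : exists a0 : fam, trivial =1 pred1 a0.
Proof.
pose z : 'I_d := Ordinal (prim_order_gt0 pr_zeta).
exists [ffun _ => z] => a; apply/forallP/eqP => [a0|-> i];
  last by rewrite ffunE; exact: eqxx.
by apply/ffunP => i; apply: val_inj; rewrite ffunE; exact: eqP (a0 i).
Qed.

(** By orthogonality: d times the indicator of d | s is the sum of the zeta ^ (k s) over k < d.
    After summation over a, each k <> 0 contributes a power of \sum_(j < d) zeta ^ (k j) = 0. *)
Lemma sum_trivial_product : (\sum_a delta a = d ^ p.-1)%N.
Proof.
have d_gt0 := prim_order_gt0 pr_zeta.
have p_gt0 : (0 < p)%N by rewrite prime_gt0 // (pcharf_prime pcharFp).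
apply/eqP; rewrite -(eqn_pmul2l d_gt0) -expnS prednK //.
rewrite -(eqr_nat algC) big_distrr natr_sum /=.
rewrite (eq_bigr (fun a : fam => \sum_(k < d) \prod_(i < p) (zeta ^+ k) ^+ a
  i)).
  rewrite exchange_big /=.
  rewrite (eq_bigr (fun k : 'I_d => (d * (d %| k))%:R ^+ p)) => [|k _];
    last first.
    rewrite -(bigA_distr_bigA (fun (i : 'I_p) (j : 'I_d) => (zeta ^+ k) ^+ j))
      /=.
    by rewrite sum_zeta_expr prodr_const card_ord.
  rewrite (bigD1 (Ordinal d_gt0)) //= dvdn0 muln1 natrX big1 ?addr0 // => k nk.
  have -> : (d %| k)%N = false.
    by rewrite /dvdn modn_small //; apply/negbTE; rewrite -val_eqE in nk.
  by rewrite muln0 expr0n gtn_eqF.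
by move=> a _; rewrite -sum_zeta_expr; apply: eq_bigr => k _;
  rewrite -exprM mulnC exprM prodrXr.
Qed.

Lemma sum_supp_size : (\sum_a supp_size a = p * (d - 1) * d ^ p.-1)%N.
Proof.
have p_gt0 : (0 < p)%N by rewrite prime_gt0 // (pcharf_prime pcharFp).
have d_gt0 := prim_order_gt0 pr_zeta.
rewrite exchange_big /= -mulnA -[p in RHS]card_ord -sum_nat_const;
  apply: eq_bigr => i _.
transitivity (\sum_(a : fam) \prod_(i' < p) (if i' == i then (a i' != 0 :> nat)
  : nat else 1))%N.
  by apply: eq_bigr => a _;
    rewrite (bigD1 i) //= eqxx big1 ?muln1 // => j /negPf->.
rewrite -(bigA_distr_bigA (fun (i' : 'I_p) (j : 'I_d) =>
   if i' == i then (j != 0 :> nat) : nat else 1%N)) /= (bigD1 i) //= eqxx.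
congr (_ * _)%N.
  rewrite -[in RHS](card_ord d) subn1 -(cardC1 (Ordinal d_gt0)) -sum1_card
    [RHS]big_mkcond.
  by apply: eq_bigr => j _; rewrite !inE -val_eqE /=; case: eqP.
rewrite (eq_bigr (fun _ => d)) => [|j /negPf->];
  last by rewrite sum1_card card_ord.
by rewrite prod_nat_const cardC1 card_ord.
Qed.

(** This says G = (p d - p - d - 1) d ^ (p - 1) + 2, written additively to avoid truncated
    subtraction. The trivial a, with support size 0 and delta 1, accounts for the 2. *)
Lemma weil_coefficientE : (G + d ^ p + d ^ p.-1 = p * (d - 1) * d ^ p.-1 + 2)%N.
Proof.
have [a0 iszE] := trivial_unique.
have card_fam : (\sum_(a : fam) 1 = d ^ p)%N by rewrite sum1_card card_ffun
  !card_ord.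
rewrite -card_fam -sum_supp_size -sum_trivial_product.
rewrite [(\sum_(a : fam) 1)%N](bigID trivial) [(\sum_(a : fam) delta
  a)%N](bigID trivial).
rewrite [in RHS](bigID trivial) /= !(eq_bigl _ _ iszE) !big_pred1_eq.
have /forallP a00 : trivial a0 by rewrite iszE /= eqxx.
have -> : supp_size a0 = 0%N by rewrite /supp_size big1 // => i _;
  rewrite (eqP (a00 i)).
have -> : delta a0 = 1%N by rewrite /delta big1 ?dvdn0 // => i _;
  rewrite (eqP (a00 i)).
rewrite [in RHS](eq_bigr (fun a => (supp_size a - 1 - delta a) + 1 + delta
  a)%N).
  rewrite !big_split /= -/G; ring.
by move=> a /twisted_sum_bound[]; have := leq_b1 (d %| \sum_(i < p) a i)%N;
  rewrite -/(delta a); lia.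
Qed.

(** The trivial a contributes q to W and 1 to \sum_a delta a = d ^ (p - 1), so the left-hand side is
    minus the sum of S a + delta a over the other a, to which Weil's bound applies termwise. *)
Lemma solution_weight_bound :
  exists2 g, (g + d ^ p + d ^ p.-1 = p * (d - 1) * d ^ p.-1 + 2)%N &
    q%:R - W%:R - (d ^ p.-1)%:R + 1 <= g%:R * sqrtC q%:R :> algC.
Proof.
exists G; first exact: weil_coefficientE.
have [a0 iszE] := trivial_unique.
have isz0 : trivial a0 by rewrite iszE /= eqxx.
have sum1 : \sum_(a | ~~ trivial a) (delta a)%:R = (d ^ p.-1)%:R - 1 :> algC.
  rewrite -sum_trivial_product [in RHS](bigID trivial) /= (eq_bigl _ _ iszE)
    big_pred1_eq natrD natr_sum.
  have -> : delta a0 = 1%N.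
    by rewrite /delta big1 ?dvdn0 // => i _; rewrite (eqP (forallP isz0 i)).
  by rewrite addrC addrA addNr add0r.
have eqW : q%:R - W%:R - (d ^ p.-1)%:R + 1 =
    - \sum_(a | ~~ trivial a) (S a + (delta a)%:R).
  rewrite solution_weightE (bigID trivial) /= (eq_bigl _ _ iszE) big_pred1_eq
    (twisted_sum_trivial isz0).
  by rewrite big_split /= sum1; ring.
have real_lhs : q%:R - W%:R - (d ^ p.-1)%:R + 1 \is @Num.real algC.
  by rewrite !(rpredD, rpredB, rpredN) ?realn ?real1.
apply: le_trans (real_ler_norm real_lhs) _; rewrite eqW normrN.
apply: le_trans (ler_norm_sum _ _ _) _; rewrite natr_sum mulr_suml.
by apply: ler_sum => a /twisted_sum_bound[].
Qed.

Hypothesis no_solution : forall x, exists i : 'I_p, chi (x + pt i) != 1.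

(** A factor with chi <> 1 is nonzero only if x + i = 0; it then equals 1, and each of the other p -
    1 factors is at most d. *)
Lemma prod_weight_le x :
  (\prod_(i < p) chi_weight (x + pt i)%R <= \sum_(i < p) (x + pt i == 0)%R * d
    ^ p.-1)%N.
Proof.
have [i chi_i] := no_solution x.
have d_gt0 := prim_order_gt0 pr_zeta.
have [xi0|xi0] := eqVneq (x + pt i) 0; last first.
  by rewrite (bigD1 i) //= /chi_weight (negPf xi0) (negPf chi_i) mul0n.
rewrite [X in (_ <= X)%N](bigD1 i) //= xi0 eqxx mul1n.
apply: leq_trans (leq_addr _ _);
  rewrite (bigD1 i) //= xi0 /chi_weight eqxx mul1n.
have <- : (\prod_(j < p | j != i) d)%N = (d ^ p.-1)%N.
  by rewrite prod_nat_const cardC1 card_ord.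
by apply: leq_prod => j _; case: ifP => // _; case: ifP.
Qed.

Lemma solution_weight_le : (W <= p * d ^ p.-1)%N.
Proof.
apply: leq_trans (leq_sum _ (fun x _ => prod_weight_le x)) _.
have -> : (p * d ^ p.-1 = \sum_(i < p) d ^ p.-1)%N by rewrite sum_nat_const
  card_ord.
rewrite exchange_big /=.
apply: leq_sum => i _; rewrite -big_distrl /= (bigD1 (- pt i)) //= addNr eqxx.
by rewrite big1 ?addn0 ?mul1n // => x nx; rewrite addr_eq0 (negPf nx).
Qed.

(** A nonzero weight would put x in the prime field, where its translates run through all residues;
    one of these, j, is nonzero with j ^ n <> 1 and makes the product vanish. *)
Lemma solution_weight_eq0 : ~~ (p.-1 %| n)%N -> W = 0%N.
Proof.
have p_pr := pcharf_prime pcharFp; have p_gt0 := prime_gt0 p_pr.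
move=> ndvd; have [j jn0 jn1] : exists2 j : 'I_p, pt j != 0 & pt j ^+ n != 1.
  apply/exists_inP; apply: contraNT ndvd;
    rewrite negb_exists_in => /forall_inP all1.
  have p1_gt0 : (0 < p.-1)%N by rewrite -subn1 subn_gt0 prime_gt1.
  have ptj1 j : pt j != 0 -> pt j ^+ p.-1 = 1.
    move=> j0; apply: (mulfI j0); rewrite -exprS prednK // mulr1.
    exact: (pFrobenius_aut_nat pcharFp).
  rewrite /dvdn; apply/negPn/negP; rewrite -lt0n => r_gt0.
  (* Otherwise all p - 1 nonzero residues would be roots of unity of the smaller positive exponent n
     mod (p - 1). *)
  have : (size [seq pt j | j <- enum [pred j : 'I_p | pt j != 0%R]] <= n %%
    p.-1)%N.
    apply: max_unity_roots r_gt0 _ _.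
      apply/allP => _ /mapP[j + ->]; rewrite mem_enum inE => j0.
      have := all1 j j0; rewrite negbK {1}(divn_eq n p.-1) exprD mulnC exprM.
      by rewrite (ptj1 j j0) expr1n mul1r unity_rootE.
    by rewrite map_inj_uniq ?enum_uniq //; exact: natr_ord_inj.
  rewrite size_map -cardE.
  have -> : #|[pred j : 'I_p | pt j != 0]| = p.-1.
    rewrite -[in RHS](card_ord p) -(cardC1 (Ordinal p_gt0)).
    apply: eq_card => j; rewrite !inE /pt -(dvdn_pcharf pcharFp) -val_eqE /=.
    congr (~~ _); rewrite /dvdn modn_small //.
  by rewrite leqNgt ltn_mod p1_gt0.
rewrite /W /solution_weight big1 // => x _; apply/eqP.
have [i0 chi_i0] := no_solution x.
have [xi0|xi0] := eqVneq (x + pt i0) 0; last first.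
  by rewrite (bigD1 i0) //= /chi_weight (negPf xi0) (negPf chi_i0) mul0n.
pose i1 := Ordinal (ltn_pmod (j + i0) p_gt0).
have xi1 : x + pt i1 = pt j.
  rewrite /pt /= (GRing.natr_mod_pchar pcharFp) natrD addrCA -/(pt i0) xi0.
  exact: addr0.
by rewrite (bigD1 i1) //= xi1 /chi_weight (negPf jn0) char_eq1 // (negPf jn1)
  mul0n.
Qed.

End CountingSolutions.

(** * Transfer to a real closed field, and conclusion *)

(** After squaring, the inequality is one between integers and holds alike in [algC] and in R. *)
Lemma sqrt_bound_transfer (R : rcfType) (z : int) (g m : nat) :
  z%:~R <= g%:R * sqrtC m%:R :> algC -> z%:~R <= g%:R * Num.sqrt m%:R :> R.
Proof.
have s0 : 0 <= sqrtC m%:R :> algC by rewrite sqrtC_ge0 ler0n.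
have r0 : 0 <= Num.sqrt m%:R :> R by exact: sqrtr_ge0.
have [z_le0 _|z_gt0] := lerP z 0.
  by apply: le_trans (_ : 0 <= _); rewrite ?lerz0 // mulr_ge0 ?ler0n.
rewrite -(@ler_pXn2r _ 2) ?nnegrE ?ler0z ?(ltW z_gt0) ?mulr_ge0 ?ler0n //.
rewrite exprMn sqrtCK => le_alg.
rewrite -(@ler_pXn2r _ 2) ?nnegrE ?ler0z ?(ltW z_gt0) ?mulr_ge0 ?ler0n //.
rewrite exprMn sqr_sqrtr ?ler0n //.
have : z ^+ 2 <= (g ^ 2 * m)%N%:Z.
  by rewrite -(ler_int algC) rmorphXn /= -pmulrn natrM natrX.
by rewrite -(ler_int R) rmorphXn /= -pmulrn natrM natrX.
Qed.

Lemma finField_prim_root (F : finFieldType) :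
  exists theta : F, (#|F|.-1).-primitive_root theta.
Proof.
have q_gt1 := card_field_gt1 F; set n := #|F|.-1.
have n_gt0 : (0 < n)%N by rewrite -ltnS prednK // ltnW.
suff /hasP[z _ pr_z] : has n.-primitive_root (enum (predC1 (0 : F))) by exists
  z.
apply: has_prim_root => //; last by rewrite -cardE cardC1.
  apply/allP => x; rewrite mem_enum inE unity_rootE => /= x0; apply/eqP.
  by apply: (mulfI x0); rewrite mulr1 -exprS prednK ?expf_card // ltnW.
exact: enum_uniq.
Qed.

(** Defined through the discrete logarithm to base theta; the result does not depend on the exponent
    since d divides q - 1, and 0, which has no logarithm, gets the default value. *)
Lemma finField_character (F : finFieldType) (theta : F) (d : nat) (zeta : algC)
  :
    (#|F|.-1).-primitive_root theta -> (d %| #|F|.-1)%N -> d.-primitive_root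
      zeta ->
  exists chi : F -> algC, chi 0 = 0 /\ forall i, chi (theta ^+ i) = zeta ^+ i.
Proof.
move=> pr_theta d_dvd pr_zeta; set q1 := #|F|.-1 in pr_theta d_dvd.
pose chi x := if [pick i : 'I_q1 | theta ^+ i == x] is Some i then zeta ^+ i
  else 0.
exists chi; rewrite /chi; split=> [|i].
  by case: pickP => // i;
    rewrite expf_eq0 (negPf (prim_root_neq0 pr_theta)) andbF.
case: pickP => [j|].
  rewrite (eq_prim_root_expr pr_theta) => eqij; apply/eqP.
  rewrite (eq_prim_root_expr pr_zeta);
    move/eqP: eqij => /(congr1 (fun m => m %% d)%N).
  by rewrite !modn_dvdm // => ->.
move/(_ (Ordinal (ltn_pmod i (prim_order_gt0 pr_theta)))).
by rewrite /= prim_expr_mod // eqxx.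
Qed.

Theorem theorem2p3 (R : rcfType) (p k q n d : nat)
    (p_prime : prime p) (k_ge1 : (1 <= k)%N) (q_def : q = (p ^ k)%N)
    (n_gt0 : (0 < n)%N) (n_dvd : (n %| q - 1)%N)
    (d_def : d = ((q - 1) %/ n)%N) :
  (q%:R - ((p%:R * d%:R - p%:R - d%:R - 1) * d%:R ^+ (p - 1) + 2)
            * Num.sqrt q%:R
        - (p%:R + 1) * d%:R ^+ (p - 1) + 1 > 0 :> R ->
   in_Np p n) /\
  (~~ (p - 1 %| n)%N ->
   q%:R - ((p%:R * d%:R - p%:R - d%:R - 1) * d%:R ^+ (p - 1) + 2)
            * Num.sqrt q%:R
        - d%:R ^+ (p - 1) + 1 > 0 :> R ->
   in_Np p n).
Proof.
have [F pcharFp cardF] := pPrimePowerField p_prime k_ge1.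
have q_card : #|F| = q by rewrite cardF q_def.
have dnE : (d * n)%N = #|F|.-1 by rewrite d_def divnK // q_card subn1.
have d_gt0 : (0 < d)%N.
  have : (0 < d * n)%N by rewrite dnE -ltnS prednK ?card_field_gt1 // ltnW
    ?card_field_gt1.
  by rewrite muln_gt0 => /andP[].
have [theta pr_theta] := finField_prim_root F.
have [zeta pr_zeta] := C_prim_root_exists d_gt0.
have d_dvd : (d %| #|F|.-1)%N by rewrite -dnE dvdn_mulr.
have [chi [chi0 chi_theta]] := finField_character pr_theta d_dvd pr_zeta.
have p_gt0 := prime_gt0 p_prime.
(* A suitable x yields the Lie algebra; without one, the point count contradicts either
   inequality. *)
have [/existsP[x /forallP chi_x]|no_sol] :=
    boolP [exists x : F, [forall i : 'I_p, chi (x + i%:R) == 1]].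
  suff : in_Np p n by [].
  have x_n j : (x + j%:R) ^+ n = 1.
    rewrite -(GRing.natr_mod_pchar pcharFp).
    have chi_j := chi_x (Ordinal (ltn_pmod j p_gt0)); apply/eqP.
    rewrite -(char_eq1 dnE pr_theta pr_zeta chi_theta) //=.
    by apply: contraTneq chi_j => /= ->; rewrite chi0 eq_sym oner_eq0.
  (* This root supplies the eigenvalue of order n on the central element. *)
  have pr_n : n.-primitive_root (theta ^+ d).
    have := exp_prim_root pr_theta d; rewrite (gcdn_idPl d_dvd) -dnE.
    by rewrite mulKn.
  rewrite -(prednK p_gt0) in pcharFp *.
  exact: (@cyc_in_Np F p.-1 x (theta ^+ d) pcharFp n x_n pr_n).
have no_solution x : exists i : 'I_p, chi (x + (i : nat)%:R) != 1.
  move: no_sol; rewrite negb_exists => /forallP/(_ x).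
  by rewrite negb_forall => /existsP.
pose W := solution_weight p d chi.
have leW := solution_weight_le pr_zeta no_solution.
have W0 := solution_weight_eq0 pcharFp cardF dnE pr_theta pr_zeta chi_theta
  no_solution.
have [G GE le_alg] :=
  solution_weight_bound pcharFp cardF dnE pr_theta pr_zeta chi0 chi_theta.
have {le_alg} : (q%:Z - W%:Z - (d ^ p.-1)%N%:Z + 1)%:~R <= G%:R * sqrtC q%:R :>
  algC.
  by rewrite rmorphD !rmorphB rmorph1 /= -q_card; exact: le_alg.
move/(sqrt_bound_transfer R);
  rewrite rmorphD !rmorphB rmorph1 /= -!pmulrn => le_R.
have GR : G%:R = (p%:R * d%:R - p%:R - d%:R - 1) * d%:R ^+ (p - 1) + 2 :> R.
  have := congr1 (fun m => m%:R : R) GE.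
  rewrite !natrD !natrM natrB // -{1}(prednK p_gt0) expnS natrM natrX subn1 =>
    eqG.
  by rewrite -[LHS](addrK (d%:R * d%:R ^+ p.-1 + d%:R ^+ p.-1)) addrA eqG; ring.
rewrite -GR !subn1; move: le_R; rewrite natrX;
  move: (_ * Num.sqrt _) => Gs le_R.
(* The two cases use W <= p d ^ (p - 1) and W = 0 respectively, whence the coefficients p + 1 and 1
   of d ^ (p - 1). *)
split=> [|ndvd] pos; exfalso; move: pos; apply/negP; rewrite -leNgt.
  have : W%:R <= p%:R * d%:R ^+ p.-1 :> R by rewrite -natrX -natrM ler_nat.
  move: le_R; lra.
move: le_R; rewrite /W W0 //; lra.
Qed.
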